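(* Consider the family of two-sided queueing systems on the bipartite graph $G(N\cup M,E)$ indexed by the scaling parameter $\eta\in\mathbb N$. Let $\boldsymbol\theta\in\mathbb R^m$, $\boldsymbol\phi\in\mathbb R^n$ be any constant vectors with strictly positive entries, let $\sigma^\eta=\eta^{2/3}$ and let $\tau_{\max}^\eta$ be any thresholds with $0\le\tau_{\max}^\eta\le\eta^{1/3}$. Operate the $\eta$-th system under the two-price policy $$\lambda_j(\mathbf q)=\eta\lambda_j^*-\theta_j\sigma^\eta\,\mathbf 1\{q_j^{(c)}>\tau_{\max}^\eta\}\ (j\in M),\qquad \mu_i(\mathbf q)=\eta\mu_i^*-\phi_i\sigma^\eta\,\mathbf 1\{q_i^{(s)}>\tau_{\max}^\eta\}\ (i\in N),$$ together with modified max-weight matching. Then the profit loss satisfies $L^\eta=O(\eta^{1/3})$ as $\eta\to\infty$.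
   Context: **Model.** $N$ is a set of $n$ server types, $M$ a set of $m$ customer types, $E\subseteq N\times M$ the set of compatible pairs. The state $\mathbf q=(q^{(c)}_j,j\in M;\ q^{(s)}_i,i\in N)\in\mathbb Z_+^{m+n}$ records the numbers of waiting customers and servers of each type. In state $\mathbf q$, type-$j$ customers arrive at Poisson rate $\lambda_j(\mathbf q)$ and type-$i$ servers at Poisson rate $\mu_i(\mathbf q)$, chosen by the operator (pricing). A matched compatible pair leaves at once. **Curves.** $F_j$ (inverse demand curve) is strictly decreasing, $G_i$ (inverse supply curve) is strictly increasing; both are nonnegative and twice continuously differentiable on the range of feasible rates, $\lambda\mapsto\lambda F_j(\lambda)$ has strictly negative second derivative, $\mu\mapsto\mu G_i(\mu)$ has strictly positive second derivative. Unit waiting costs $s_j^{(c)},s_i^{(s)}>0$ are given. **Fluid problem.** $\gamma^*=\max\sum_j\lambda_jF_j(\lambda_j)-\sum_i\mu_iG_i(\mu_i)$ over $\boldsymbol\lambda,\boldsymbol\mu,\boldsymbol\chi$ subject to $\lambda_j=\sum_i\chi_{ij}$, $\mu_i=\sum_j\chi_{ij}$, $\chi_{ij}\ge0$ for $(i,j)\in E$ and $\chi_{ij}=0$ for $(i,j)\notin E$. $(\boldsymbol\lambda^*,\boldsymbol\mu^*,\boldsymbol\chi^* )$ denotes an optimal solution; it is assumed that $\boldsymbol\lambda^*,\boldsymbol\mu^*>0$. **Scaling.** The $\eta$-th system has the same graph and waiting costs, with curves $F^\eta_j(\eta\lambda)=F_j(\lambda)$, $G_i^\eta(\eta\mu)=G_i(\mu)$;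 its fluid optimum is $\eta\gamma^*$. Only $\eta$ large enough that all rates of the two-price policy are nonnegative is considered. **Profit loss.** With $\mathbb E$ the stationary expectation, $$L^\eta=\eta\gamma^*-\Big(\mathbb E\Big[\sum_j\lambda_j(\mathbf q)F_j^\eta(\lambda_j(\mathbf q))-\sum_i\mu_i(\mathbf q)G_i^\eta(\mu_i(\mathbf q))\Big]-\sum_js_j^{(c)}\mathbb E[q_j^{(c)}]-\sum_is_i^{(s)}\mathbb E[q_i^{(s)}]\Big).$$ **Modified max-weight matching.** An edge $(i,j)\in E$ is *redundant* if $\chi^*_{ij}=0$ in every optimal solution of the fluid problem; $E_r$ is the set of redundant edges. Under modified max-weight matching only edges of $E\setminus E_r$ are used: an arriving server of type $i$ is immediately matched with a waiting customer of a type $j$ maximizing $q_j^{(c)}$ over $\{j:(i,j)\in E\setminus E_r\}$ if this maximum is positive; symmetrically for an arriving customer. Ties are broken arbitrarily. If all these queues are empty, the arrival joins its own queue.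
   Formalization: The range of feasible rates is any interval of nonnegative reals, the fluid problem is restricted to it, and the optimal rates λ*, μ* are assumed interior to it (automatic for [0,∞)); at a binding upper end the loss can be of order η^{2/3}. *)

(* Defs.v *)
From HB Require Import structures.
From mathcomp Require Import all_boot all_order all_algebra.
From mathcomp Require Import all_classical all_reals all_analysis.

Set Implicit Arguments.
Unset Strict Implicit.
Unset Printing Implicit Defensive.

Import Order.TTheory GRing.Theory Num.Theory.
Import numFieldNormedType.Exports.

Local Open Scope classical_set_scope.
Local Open Scope ring_scope.

(* Differentiability of a curve on a range of rates that need not be open:
   at an endpoint of [D] the limit is one-sided. *)
Definition derivative_on (R : realType) (D : set R) (f f' : R -> R) : Prop :=
  forall x, D x -> (f y - f x) / (y - x) @[y --> within D x^'] --> f' x.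

Definition second_derivative_on (R : realType) (D : set R) (f f2 : R -> R) :
  Prop := exists2 f1, derivative_on D f f1 & derivative_on D f1 f2.

Definition twice_continuously_differentiable_on (R : realType) (D : set R)
    (f : R -> R) : Prop :=
  exists2 f2, second_derivative_on D f f2 & {within D, continuous f2}.

(* [N] is the set of server types and [M] the set of customer types. *)
Record market (R : realType) (N M : finType) := Market {
  compat : {set N * M};
  cust_range : M -> interval R;   (* feasible arrival rates *)
  serv_range : N -> interval R;
  demand : M -> R -> R;           (* inverse demand curves F_j *)
  supply : N -> R -> R;           (* inverse supply curves G_i *)
  cust_cost : M -> R;             (* unit waiting costs *)
  serv_cost : N -> R }.

Definition market_assumptions (R : realType) (N M : finType)
    (K : market R N M) : Prop :=
  (forall j, let D := [set` cust_range K j] in let F := demand K j in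
    [/\ forall x, D x -> 0 <= x,
        forall x, D x -> 0 <= F x,
        forall x y, D x -> D y -> x < y -> F y < F x,
        twice_continuously_differentiable_on D F &
        exists2 f2, second_derivative_on D (fun x => x * F x) f2 &
          forall x, D x -> f2 x < 0]) /\
  (forall i, let D := [set` serv_range K i] in let G := supply K i in
    [/\ forall x, D x -> 0 <= x,
        forall x, D x -> 0 <= G x,
        forall x y, D x -> D y -> x < y -> G x < G y,
        twice_continuously_differentiable_on D G &
        exists2 f2, second_derivative_on D (fun x => x * G x) f2 &
          forall x, D x -> 0 < f2 x]) /\
  (forall j, 0 < cust_cost K j) /\
  (forall i, 0 < serv_cost K i).

Definition fluid_feasible (R : realType) (N M : finType) (K : market R N M)
    (lam : M -> R) (mu : N -> R) (chi : N -> M -> R) : Prop :=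
  [/\ forall j, lam j \in cust_range K j,
      forall i, mu i \in serv_range K i,
      forall j, lam j = \sum_i chi i j,
      forall i, mu i = \sum_j chi i j &
      forall i j, ((i, j) \in compat K -> 0 <= chi i j) /\
                  ((i, j) \notin compat K -> chi i j = 0)].

Definition fluid_profit (R : realType) (N M : finType) (K : market R N M)
    (lam : M -> R) (mu : N -> R) : R :=
  \sum_j lam j * demand K j (lam j) - \sum_i mu i * supply K i (mu i).

Definition fluid_optimal (R : realType) (N M : finType) (K : market R N M)
    (lam : M -> R) (mu : N -> R) (chi : N -> M -> R) : Prop :=
  fluid_feasible K lam mu chi /\
  forall lam' mu' chi', fluid_feasible K lam' mu' chi' ->
    fluid_profit K lam' mu' <= fluid_profit K lam mu.

Definition redundant (R : realType) (N M : finType) (K : market R N M) :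
  {set N * M} :=
  [set e in compat K | `[< forall lam mu chi,
     fluid_optimal K lam mu chi -> chi e.1 e.2 = 0 >]].

(* Numbers of waiting customers (first component) and servers (second). *)
Notation state N M := ({ffun M -> nat} * {ffun N -> nat})%type.

Definition incr (T : finType) (q : {ffun T -> nat}) (t : T) :
  {ffun T -> nat} := [ffun u => (q u + (u == t))%N].

Definition decr (T : finType) (q : {ffun T -> nat}) (t : T) :
  {ffun T -> nat} := [ffun u => (q u - (u == t))%N].

(* Candidate partners of an arriving customer (server) when only the edges of
   [A] are used: the longest nonempty compatible queues.  These sets are empty
   exactly when all the compatible queues are empty. *)
Definition best_servers (N M : finType) (A : {set N * M}) (q : state N M)
    (j : M) : {set N} :=
  [set i : N | [&& (i, j) \in A, (0 < q.2 i)%N &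
    [forall i' : N, ((i', j) \in A) ==> (q.2 i' <= q.2 i)%N]]].

Definition best_customers (N M : finType) (A : {set N * M}) (q : state N M)
    (i : N) : {set M} :=
  [set j : M | [&& (i, j) \in A, (0 < q.1 j)%N &
    [forall j' : M, ((i, j') \in A) ==> (q.1 j' <= q.1 j)%N]]].

(* A possibly randomized, state-dependent way of breaking ties:
   [tie_cust q j i] is the probability that a type-[j] customer arriving in
   state [q] is matched with a type-[i] server. *)
Record tie_rule (R : realType) (N M : finType) := TieRule {
  tie_cust : state N M -> M -> N -> R;
  tie_serv : state N M -> N -> M -> R }.

Definition valid_tie_rule (R : realType) (N M : finType) (A : {set N * M})
    (t : tie_rule R N M) : Prop :=
  (forall q j, best_servers A q j != finset.set0 ->
    (forall i, 0 <= tie_cust t q j i) /\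
    \sum_(i in best_servers A q j) tie_cust t q j i = 1) /\
  (forall q i, best_customers A q i != finset.set0 ->
    (forall j, 0 <= tie_serv t q i j) /\
    \sum_(j in best_customers A q i) tie_serv t q i j = 1).

(* Probability that an arrival in state [q] leads to state [q']. *)
Definition cust_jump (R : realType) (N M : finType) (A : {set N * M})
    (t : tie_rule R N M) (q : state N M) (j : M) (q' : state N M) : R :=
  if best_servers A q j == finset.set0 then (q' == (incr q.1 j, q.2))%:R
  else \sum_(i in best_servers A q j)
         tie_cust t q j i * (q' == (q.1, decr q.2 i))%:R.

Definition serv_jump (R : realType) (N M : finType) (A : {set N * M})
    (t : tie_rule R N M) (q : state N M) (i : N) (q' : state N M) : R :=
  if best_customers A q i == finset.set0 then (q' == (q.1, incr q.2 i))%:R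
  else \sum_(j in best_customers A q i)
         tie_serv t q i j * (q' == (decr q.1 j, q.2))%:R.

Definition jump_rate (R : realType) (N M : finType) (A : {set N * M})
    (t : tie_rule R N M) (lam : state N M -> M -> R)
    (mu : state N M -> N -> R) (q q' : state N M) : R :=
  \sum_j lam q j * cust_jump A t q j q' +
  \sum_i mu q i * serv_jump A t q i q'.

(* Stationary distributions of the continuous-time Markov chain on the state
   space, by global balance; every arrival changes the state, so that the total
   arrival rate is the rate at which a state is left. *)
Definition stationary (R : realType) (N M : finType) (A : {set N * M})
    (t : tie_rule R N M) (lam : state N M -> M -> R)
    (mu : state N M -> N -> R) (pi : state N M -> R) : Prop :=
  [/\ forall q, 0 <= pi q,
      \esum_(q in [set: state N M]) (pi q)%:E = 1%:E &
      forall q', \esum_(q in [set: state N M])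
                   (pi q * jump_rate A t lam mu q q')%:E =
                 (pi q' * (\sum_j lam q' j + \sum_i mu q' i))%:E].

Definition expectation_of (R : realType) (N M : finType)
    (pi : state N M -> R) (f : state N M -> R) : \bar R :=
  (\esum_(q in [set: state N M]) (pi q * Num.max (f q) 0)%:E -
   \esum_(q in [set: state N M]) (pi q * Num.max (- f q) 0)%:E)%E.

Definition scaled_curve (R : realType) (eta : nat) (f : R -> R) : R -> R :=
  fun x => f (x / eta%:R).

Definition price_shift (R : realType) (eta : nat) : R := eta%:R `^ (2 / 3).

Definition two_price_cust (R : realType) (N M : finType) (eta : nat)
    (lams theta : M -> R) (tau : R) (q : state N M) (j : M) : R :=
  eta%:R * lams j - theta j * price_shift R eta * (tau < (q.1 j)%:R)%R%:R.

Definition two_price_serv (R : realType) (N M : finType) (eta : nat)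
    (mus phi : N -> R) (tau : R) (q : state N M) (i : N) : R :=
  eta%:R * mus i - phi i * price_shift R eta * (tau < (q.2 i)%:R)%R%:R.

(* [gam] is the optimal value of the fluid problem. The loss is an extended
   real: it is +oo when some mean queue length is infinite. *)
Definition profit_loss (R : realType) (N M : finType) (K : market R N M)
    (eta : nat) (gam : R) (lam : state N M -> M -> R)
    (mu : state N M -> N -> R) (pi : state N M -> R) : \bar R :=
  ((eta%:R * gam)%:E -
   (expectation_of pi (fun q =>
      (\sum_j lam q j * scaled_curve eta (demand K j) (lam q j) -
       \sum_i mu q i * scaled_curve eta (supply K i) (mu q i))%R) -
    \sum_j (cust_cost K j)%:E * expectation_of pi (fun q => (q.1 j)%:R%R) -
    \sum_i (serv_cost K i)%:E * expectation_of pi (fun q => (q.2 i)%:R%R)))%E.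

(* Main.v *)
Require Import Defs.
From mathcomp Require Import all_boot all_order all_algebra.
From mathcomp Require Import all_classical all_reals all_analysis.
From mathcomp Require Import finmap zify ring lra.
Import Order.TTheory GRing.Theory Num.Theory.
Import numFieldNormedType.Exports.
Set Implicit Arguments.
Unset Strict Implicit.
Unset Printing Implicit Defensive.
Local Open Scope classical_set_scope.
Local Open Scope ring_scope.

(* Strict concavity makes the optimal rates unique, so averaging optimal flows
   gives an optimal flow [chi] that is positive on every nonredundant edge.

   With [T = eta^(1/3)] the price shift is [T^2].  Write the longest partner
   queue as a maximum and compare it with the [chi]-weighted average: for
   [V] the sum of the squared queue lengths, the terms of order [T^3] in the
   drift of [V] are at most 0, and the price shifts contribute
   [- 2 kappa T^2] times the total queue length up to [O(T^3)].  Hence a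
   stationary distribution exists and the mean total queue length is [O(T)].

   The revenue differs from its fluid value by a first-order term of order
   [T^2] and a second-order term of order [T^3 (1/T)^2 = T].  Perturbing [chi]
   along one edge shows that marginal revenue and marginal cost agree along
   nonredundant edges.  So the queue lengths weighted by these marginal values
   form a linear function whose drift is exactly the first-order term; its
   stationary mean is 0. *)

(** * Expectations *)

(** A shift [sigma] yields mean queues of order [eta / sigma] and a second-order revenue error of
    order [sigma ^+ 2 / eta]; the two balance at the exponent 2/3.

    The first-order revenue term cannot be bounded through the probability that a queue exceeds its
    threshold: [tau] may be 0 and this probability need not be small. The term has to cancel
    exactly. This is why only nonredundant edges are used: along a redundant edge the marginal
    values may differ, and a match there would not move the linear function by the same amount as a
    joining arrival.

    All that is known of a stationary distribution is global balance, and queue lengths are not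
    integrable a priori; so the drift inequality is first applied to bounded truncations. Existence
    comes from tightness, without a study of communicating classes. Finally, the state space
    contains states in which compatible queues on both sides are nonempty. There the reduced rates
    produce positive drift terms, which are absorbed because, for large [eta], every fluid rate
    dominates the sum of all price shifts. *)

Section Expectation.
Variables (R : realType) (S : choiceType) (pi : S -> R).
Implicit Types (f g : S -> R) (c B : R).

Definition weighted_sum (f : S -> R) : \bar R :=
  \esum_(q in [set: S]) (pi q * f q)%:E.

(* [expectation_of] on an arbitrary state space. *)
Definition mean (f : S -> R) : \bar R :=
  (weighted_sum (fun q => Num.max (f q) 0)%R -
   weighted_sum (fun q => Num.max (- f q) 0)%R)%E.

Definition integrable_wrt (f : S -> R) : Prop :=
  (weighted_sum (fun q => `|f q|)%R < +oo)%E.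

Definition rmean (f : S -> R) : R := fine (mean f).

Hypothesis pi_ge0 : forall q, 0 <= pi q.

Lemma weighted_sum_ge0 f : (forall q, 0 <= f q) -> (0 <= weighted_sum f)%E.
Proof. by move=> f0; apply: esum_ge0 => q _; rewrite lee_fin mulr_ge0. Qed.

Lemma le_weighted_sum f g : (forall q, f q <= g q) ->
  (weighted_sum f <= weighted_sum g)%E.
Proof. by move=> fg; apply: le_esum => q _; rewrite lee_fin ler_wpM2l. Qed.

Lemma weighted_sumD f g : (forall q, 0 <= f q) -> (forall q, 0 <= g q) ->
  weighted_sum (fun q => f q + g q) = (weighted_sum f + weighted_sum g)%E.
Proof.
move=> f0 g0; rewrite -esumD; first by apply: eq_esum => q _; rewrite mulrDr.
- by move=> q _; rewrite lee_fin mulr_ge0.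
- by move=> q _; rewrite lee_fin mulr_ge0.
Qed.

Lemma weighted_sumZ c f : 0 <= c ->
  weighted_sum (fun q => c * f q) = (c%:E * weighted_sum f)%E.
Proof.
move=> c0; rewrite /weighted_sum /esum -ereal_supZl //; last first.
  by apply/set0P; eexists; exists set0; [exact: fsets_set0|reflexivity].
congr ereal_sup; rewrite image_comp; apply: eq_imagel => X [finX _] /=.
rewrite !fsbig_finite//= !sumEFin -EFinM; congr EFin; rewrite mulr_sumr.
by apply: eq_bigr => q _; rewrite mulrCA.
Qed.

Lemma weighted_sum_fin f : (forall q, 0 <= f q) -> integrable_wrt f ->
  weighted_sum f \is a fin_num.
Proof.
move=> f0 If; rewrite ge0_fin_numE ?weighted_sum_ge0//.
apply: le_lt_trans If; apply: le_weighted_sum => q; exact: ler_norm.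
Qed.

Lemma le_integrable_wrt f g : (forall q, `|f q| <= g q) ->
  (weighted_sum g < +oo)%E -> integrable_wrt f.
Proof. by move=> fg; apply: le_lt_trans; exact: le_weighted_sum. Qed.

Lemma integrable_wrtD f g : integrable_wrt f -> integrable_wrt g ->
  integrable_wrt (fun q => f q + g q).
Proof.
move=> If Ig; apply: (@le_integrable_wrt _ (fun q => `|f q| + `|g q|)).
  by move=> q; exact: ler_normD.
by rewrite weighted_sumD// lte_add_pinfty.
Qed.

Lemma integrable_wrtZ c f : integrable_wrt f -> integrable_wrt (fun q => c * f q).
Proof.
move=> If; apply: (@le_integrable_wrt _ (fun q => `|c| * `|f q|)).
  by move=> q; rewrite normrM.
by rewrite weighted_sumZ// lte_mul_pinfty.
Qed.

Lemma integrable_wrtN f : integrable_wrt f -> integrable_wrt (fun q => - f q).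
Proof.
move=> If; rewrite (_ : (fun q => _) = fun q => -1 * f q).
  exact: integrable_wrtZ.
by apply/funext => q; rewrite mulN1r.
Qed.

Lemma integrable_wrt_sum (T : Type) (r : seq T) (P : pred T) (f : T -> S -> R) :
  (forall t, P t -> integrable_wrt (f t)) ->
  integrable_wrt (fun q => \sum_(t <- r | P t) f t q).
Proof.
move=> If; elim: r => [|t r IH].
  apply: (@le_integrable_wrt _ (fun q => 0)) => [q|]; first by rewrite big_nil normr0.
  by rewrite /weighted_sum esum1 ?ltry// => q _; rewrite mulr0.
have [Pt|nPt] := boolP (P t).
  rewrite (_ : (fun q => _) = fun q => f t q + \sum_(t <- r | P t) f t q).
    exact: integrable_wrtD (If _ Pt) IH.
  by apply/funext => q; rewrite big_cons Pt.
by under [X in integrable_wrt X]funext do rewrite big_cons (negbTE nPt).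
Qed.

Lemma summable_weighted f : integrable_wrt f ->
  summable [set: S] (fun q => (pi q * f q)%:E).
Proof.
rewrite /integrable_wrt /weighted_sum /summable => If.
rewrite (eq_esum (b := fun q => (pi q * `|f q|)%:E)) // => q _ /=.
by rewrite normrM (ger0_norm (pi_ge0 q)).
Qed.

(** Any splitting into nonnegative integrable functions computes the mean, not only the one into
    positive and negative parts; linearity of [rmean] rests on this. *)
Lemma mean_sub f g : (forall q, 0 <= f q) -> (forall q, 0 <= g q) ->
  integrable_wrt f -> integrable_wrt g ->
  mean (fun q => f q - g q) = (weighted_sum f - weighted_sum g)%E.
Proof.
move=> f0 g0 If Ig; rewrite /mean /weighted_sum.
have := esumB (summable_weighted If) (summable_weighted Ig).
move=> <-; [|by move=> q _; rewrite lee_fin mulr_ge0..].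
congr (_ - _)%E; apply: eq_esum => q _.
  by rewrite funeposE /= -EFin_max maxr_pMr// mulr0 mulrBr.
by rewrite funenegE /= -EFin_max maxr_pMr// mulr0 mulrN mulrBr.
Qed.

Lemma mean_ge0E f : (forall q, 0 <= f q) -> mean f = weighted_sum f.
Proof.
move=> f0; rewrite /mean (_ : weighted_sum (fun q => Num.max (- f q) 0) = 0%E).
  rewrite sube0; congr weighted_sum; apply/funext => q.
  by apply/max_idPl.
rewrite /weighted_sum esum1// => q _; rewrite (max_idPr _) ?mulr0//.
by rewrite oppr_le0.
Qed.

Lemma integrable_wrt_pos f : integrable_wrt f ->
  integrable_wrt (fun q => Num.max (f q) 0).
Proof.
move=> If; apply: le_integrable_wrt If => q.
by rewrite ger0_norm ?le_max ?lexx ?orbT// ge_max normr_ge0 ler_norm.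
Qed.

Lemma integrable_wrt_neg f : integrable_wrt f ->
  integrable_wrt (fun q => Num.max (- f q) 0).
Proof.
move=> If; apply: le_integrable_wrt If => q.
by rewrite ger0_norm ?le_max ?lexx ?orbT// ge_max normr_ge0 -normrN ler_norm.
Qed.

Lemma maxr_subN (x : R) : Num.max x 0 - Num.max (- x) 0 = x.
Proof.
have [x0|x0] := leP 0 x; last by rewrite max_l ?oppr_ge0 ?ltW// sub0r opprK.
by rewrite max_r ?oppr_le0// subr0.
Qed.

Let pos0 (f : S -> R) q : 0 <= Num.max (f q) 0.
Proof. by rewrite le_max lexx orbT. Qed.

Lemma mean_fin f : integrable_wrt f -> mean f \is a fin_num.
Proof.
move=> If; rewrite /mean fin_numB; apply/andP; split.
  exact: weighted_sum_fin (pos0 f) (integrable_wrt_pos If).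
exact: weighted_sum_fin (pos0 (fun q => - f q)) (integrable_wrt_neg If).
Qed.

Lemma meanE f : integrable_wrt f -> mean f = (rmean f)%:E.
Proof. by move=> If; rewrite /rmean fineK// mean_fin. Qed.

Lemma rmean_sub f g : (forall q, 0 <= f q) -> (forall q, 0 <= g q) ->
  integrable_wrt f -> integrable_wrt g ->
  rmean (fun q => f q - g q) = fine (weighted_sum f) - fine (weighted_sum g).
Proof.
by move=> f0 g0 If Ig; rewrite /rmean mean_sub// fineB// weighted_sum_fin.
Qed.

Lemma rmeanD f g : integrable_wrt f -> integrable_wrt g ->
  rmean (fun q => f q + g q) = rmean f + rmean g.
Proof.
move=> If Ig; have p0 := pos0; have n0 f' := pos0 (fun q => - f' q).
pose fp q := Num.max (f q) 0 + Num.max (g q) 0.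
pose fn q := Num.max (- f q) 0 + Num.max (- g q) 0.
rewrite (_ : (fun q => _) = fun q => fp q - fn q); last first.
  by apply/funext => q; rewrite opprD addrACA !maxr_subN.
rewrite rmean_sub; [|by move=> q; rewrite addr_ge0..| |]; last 2 first.
- by apply: integrable_wrtD; exact: integrable_wrt_pos.
- by apply: integrable_wrtD; exact: integrable_wrt_neg.
rewrite /fp /fn (weighted_sumD (p0 f) (p0 g)) (weighted_sumD (n0 f) (n0 g)).
have fpf := weighted_sum_fin (p0 f) (integrable_wrt_pos If).
have fpg := weighted_sum_fin (p0 g) (integrable_wrt_pos Ig).
have fnf := weighted_sum_fin (n0 f) (integrable_wrt_neg If).
have fng := weighted_sum_fin (n0 g) (integrable_wrt_neg Ig).
rewrite (fineD fpf fpg) (fineD fnf fng).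
rewrite opprD addrACA.
rewrite -(rmean_sub (p0 f) (n0 f) (integrable_wrt_pos If) (integrable_wrt_neg If)).
rewrite -(rmean_sub (p0 g) (n0 g) (integrable_wrt_pos Ig) (integrable_wrt_neg Ig)).
by congr (rmean _ + rmean _); apply/funext => q; rewrite maxr_subN.
Qed.

Lemma rmean_ge0 f : (forall q, 0 <= f q) -> 0 <= rmean f.
Proof. by move=> f0; rewrite /rmean mean_ge0E// fine_ge0// weighted_sum_ge0. Qed.

Lemma rmeanN f : integrable_wrt f -> rmean (fun q => - f q) = - rmean f.
Proof.
move=> If; rewrite /rmean /mean fineB; last 2 first.
- exact: weighted_sum_fin (pos0 (fun q => - f q)) (integrable_wrt_neg If).
- under [X in weighted_sum X]funext do rewrite opprK.
  exact: weighted_sum_fin (pos0 f) (integrable_wrt_pos If).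
rewrite fineB; last 2 first.
- exact: weighted_sum_fin (pos0 f) (integrable_wrt_pos If).
- exact: weighted_sum_fin (pos0 (fun q => - f q)) (integrable_wrt_neg If).
rewrite opprB; congr (_ - fine (weighted_sum _)).
by apply/funext => q; rewrite opprK.
Qed.

Lemma rmeanZ c f : integrable_wrt f -> rmean (fun q => c * f q) = c * rmean f.
Proof.
move=> If; wlog c0 : c / 0 <= c => [hw|].
  have [/hw//|c0] := leP 0 c.
  have := hw (- c); rewrite oppr_ge0 => /(_ (ltW c0)).
  under [X in rmean X]funext do rewrite mulNr.
  by rewrite (rmeanN (integrable_wrtZ c If)) mulNr => /oppr_inj.
have p0 := pos0 f; have n0 := pos0 (fun q => - f q).
have Ip := integrable_wrt_pos If; have In := integrable_wrt_neg If.
rewrite (_ : (fun q => _) =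
  fun q => c * Num.max (f q) 0 - c * Num.max (- f q) 0); last first.
  by apply/funext => q; rewrite -mulrBr maxr_subN.
rewrite rmean_sub; [|by move=> q; rewrite mulr_ge0|by move=> q; rewrite mulr_ge0
  |exact: integrable_wrtZ|exact: integrable_wrtZ].
rewrite !weighted_sumZ// !fineM ?weighted_sum_fin//= -mulrBr -rmean_sub//.
by congr (_ * rmean _); apply/funext => q; rewrite maxr_subN.
Qed.

Lemma ler_rmean f g : integrable_wrt f -> integrable_wrt g ->
  (forall q, f q <= g q) -> rmean f <= rmean g.
Proof.
move=> If Ig fg; rewrite -subr_ge0 -rmeanN// -rmeanD//; last exact: integrable_wrtN.
by apply: rmean_ge0 => q; rewrite subr_ge0.
Qed.

Hypothesis pi_total : (\esum_(q in [set: S]) (pi q)%:E = 1%:E)%E.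

Lemma integrable_wrt_bounded f (B : R) : (forall q, `|f q| <= B) -> integrable_wrt f.
Proof.
move=> fB; apply: (@le_integrable_wrt _ (fun q => `|B| * 1)) => [q|].
  by rewrite mulr1 (le_trans (fB q))// ler_norm.
rewrite weighted_sumZ// lte_mul_pinfty//.
rewrite /weighted_sum (eq_esum (b := fun q => (pi q)%:E)) ?pi_total ?ltry//.
by move=> q _; rewrite mulr1.
Qed.

Lemma rmean_cst c : rmean (fun=> c) = c.
Proof.
rewrite (_ : (fun=> c) = fun q => c * 1); last by apply/funext=> q; rewrite mulr1.
rewrite rmeanZ; last by apply: (@integrable_wrt_bounded _ 1) => q; rewrite normr1.
rewrite /rmean mean_ge0E// /weighted_sum (eq_esum (b := fun q => (pi q)%:E)).
  by rewrite pi_total mulr1.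
by move=> q _; rewrite mulr1.
Qed.

End Expectation.

(** * Stationary distributions of countable Markov chains *)

Lemma esum_exchange (R : realType) (T1 T2 : choiceType)
    (a : T1 -> T2 -> \bar R) : (forall i j, 0 <= a i j)%E ->
  \esum_(i in [set: T1]) \esum_(j in [set: T2]) a i j =
  \esum_(j in [set: T2]) \esum_(i in [set: T1]) a i j.
Proof.
move=> a0; rewrite !esum_esum//.
rewrite (reindex_esum ([set: T2] `*`` (fun=> [set: T1])) _
  (fun p => (p.2, p.1)))//=.
split=> //; first by move=> [x y] [x' y'] _ _ [-> ->].
by move=> [x y] _; exists (y, x).
Qed.

Lemma esum_fset_support (R : realType) (T : choiceType) (X : {fset T})
    (a : T -> \bar R) : (forall x, 0 <= a x)%E ->
  (forall x, x \notin X -> a x = 0%E) ->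
  \esum_(x in [set: T]) a x = (\sum_(x <- X) a x)%E.
Proof.
move=> a0 aX; rewrite -[X in RHS]set_fsetK -fsbig_finite// -esum_fset//.
rewrite [RHS]esum_mkcond; apply: eq_esum => x _; case: ifPn => //.
by rewrite notin_setE /= => /negP/aX.
Qed.

Section Chain.
Variables (R : realType) (S : choiceType) (I : finType).
Variables (w : S -> I -> R) (tgt : S -> I -> S).
Implicit Types (f g V : S -> R) (b c : R).

(** A state is left through finitely many labelled events, with rate [w q e] and target [tgt q e].
    The generator is thus a finite sum, and infinite sums occur only in means. *)
Definition total_rate q := \sum_e w q e.
Definition jump (f : S -> R) q := \sum_e w q e * f (tgt q e).
Definition gen f q := jump f q - total_rate q * f q.

Definition is_stationary (pi : S -> R) : Prop :=
  [/\ forall q, 0 <= pi q,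
      \esum_(q in [set: S]) (pi q)%:E = 1%:E &
      forall q', \esum_(q in [set: S])
                   (pi q * jump (fun x => (q' == x)%:R) q)%:E =
                 (pi q' * total_rate q')%:E].

Hypothesis w_ge0 : forall q e, 0 <= w q e.

Lemma total_rate_ge0 q : 0 <= total_rate q.
Proof. exact: sumr_ge0. Qed.

Lemma jump_ge0 f q : (forall q, 0 <= f q) -> 0 <= jump f q.
Proof. by move=> f0; apply: sumr_ge0 => e _; rewrite mulr_ge0. Qed.

Lemma le_jump f g q : (forall q, f q <= g q) -> jump f q <= jump g q.
Proof. by move=> fg; apply: ler_sum => e _; rewrite ler_wpM2l. Qed.

Lemma jumpD f g q : jump (fun x => f x + g x) q = jump f q + jump g q.
Proof. by rewrite -big_split; apply: eq_bigr => e _; rewrite mulrDr. Qed.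

Lemma jumpZ c f q : jump (fun x => c * f x) q = c * jump f q.
Proof. by rewrite mulr_sumr; apply: eq_bigr => e _; rewrite mulrCA. Qed.

Lemma jump_cst c q : jump (fun=> c) q = total_rate q * c.
Proof. by rewrite mulr_suml. Qed.

Section Stationary.
Variable pi : S -> R.
Hypothesis pi_stat : is_stationary pi.
Let pi_ge0 q : 0 <= pi q. Proof. by case: pi_stat. Qed.
Let pi_total : (\esum_(q in [set: S]) (pi q)%:E = 1%:E)%E.
Proof. by case: pi_stat. Qed.

(** Global balance is the case of an indicator. A nonnegative [g] is a sum of multiples of
    indicators, so exchanging the sums gives the identity, even when both sides are infinite. *)
Lemma weighted_sum_jump g : (forall q, 0 <= g q) ->
  weighted_sum pi (jump g) = weighted_sum pi (fun q => total_rate q * g q).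
Proof.
move=> g0; have [_ _ bal] := pi_stat.
transitivity (\esum_(q in [set: S]) \esum_(q' in [set: S])
    (pi q * (g q' * jump (fun x => (q' == x)%:R) q))%:E); last first.
  rewrite esum_exchange => [|q q']; last first.
    by rewrite lee_fin !mulr_ge0// jump_ge0.
  apply: eq_esum => q' _.
  have /= := weighted_sumZ pi (jump (fun x => (q' == x)%:R)) (g0 q').
  rewrite {1}/weighted_sum => ->.
  by rewrite /weighted_sum bal -EFinM; congr EFin; ring.
apply: eq_esum => q _.
rewrite (eq_esum (b := fun q' =>
    (\sum_e (pi q * (w q e * (g q' * (q' == tgt q e)%:R)))%:E)%E)); last first.
  move=> q' _; rewrite /jump sumEFin; congr EFin; rewrite !mulr_sumr.
  by apply: eq_bigr => e _; ring.
rewrite esum_sum; last by move=> q' e _ _; rewrite lee_fin !mulr_ge0.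
rewrite /jump mulr_sumr -sumEFin; apply: eq_bigr => e _.
rewrite (@esum_fset_support _ _ [fset tgt q e]%fset); last 2 first.
- by move=> q'; rewrite lee_fin !mulr_ge0.
- by move=> q'; rewrite inE => /negbTE->; rewrite !mulr0.
by rewrite big_seq_fset1 eqxx mulr1.
Qed.

Variable L : R.
Hypothesis rate_le : forall q, total_rate q <= L.

Lemma weighted_sum_rate_lt_pinfty g : (forall q, 0 <= g q) ->
  integrable_wrt pi g ->
  (weighted_sum pi (fun q => (total_rate q * g q)%R) < +oo)%E.
Proof.
move=> g0 Ig; apply: (@le_lt_trans _ _ (weighted_sum pi (fun q => `|L| * g q))).
  apply: le_weighted_sum => // q; apply: ler_wpM2r => //.
  by rewrite (le_trans (rate_le q))// ler_norm.
rewrite weighted_sumZ// lte_mul_pinfty//.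
by have := weighted_sum_fin pi_ge0 g0 Ig; rewrite fin_numElt => /andP[].
Qed.

Lemma integrable_jump g : integrable_wrt pi g -> integrable_wrt pi (jump g).
Proof.
move=> Ig; apply: (le_integrable_wrt pi_ge0 (g := jump (fun x => `|g x|))) => [q|].
  apply: le_trans (ler_norm_sum _ _ _) _; apply: ler_sum => e _.
  by rewrite normrM ger0_norm.
rewrite weighted_sum_jump//; apply: weighted_sum_rate_lt_pinfty => //.
by apply: (le_integrable_wrt pi_ge0 (g := (fun q => `|g q|))) => // q; rewrite normr_id.
Qed.

Lemma integrable_rate g : integrable_wrt pi g ->
  integrable_wrt pi (fun q => total_rate q * g q).
Proof.
move=> Ig.
apply: (le_integrable_wrt pi_ge0 (g := (fun q => total_rate q * `|g q|))) => // [q|].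
  by rewrite normrM ger0_norm ?total_rate_ge0.
apply: weighted_sum_rate_lt_pinfty => //.
by apply: (le_integrable_wrt pi_ge0 (g := (fun q => `|g q|))) => // q; rewrite normr_id.
Qed.

(** [weighted_sum_jump] applies to the positive and negative parts separately; bounded rates keep
    the four sums finite, so that they cancel. *)
Lemma rmean_gen g : integrable_wrt pi g -> rmean pi (gen g) = 0.
Proof.
move=> Ig.
pose p q := Num.max (g q) 0; pose n q := Num.max (- g q) 0.
have p0 q : 0 <= p q by rewrite le_max lexx orbT.
have n0 q : 0 <= n q by rewrite le_max lexx orbT.
have Ip : integrable_wrt pi p by exact: integrable_wrt_pos.
have In : integrable_wrt pi n by exact: integrable_wrt_neg.
have gpn q : g q = p q + (-1) * n q by rewrite mulN1r maxr_subN.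
rewrite (_ : gen g = fun q => (jump p q + total_rate q * n q) -
    (jump n q + total_rate q * p q)); last first.
  apply/funext => q; rewrite /gen (_ : g = fun q => p q + (-1) * n q).
    by rewrite jumpD jumpZ; ring.
  exact/funext.
have jp q : 0 <= jump p q by rewrite jump_ge0.
have jn q : 0 <= jump n q by rewrite jump_ge0.
have rp q : 0 <= total_rate q * p q by rewrite mulr_ge0// total_rate_ge0.
have rn q : 0 <= total_rate q * n q by rewrite mulr_ge0// total_rate_ge0.
rewrite rmean_sub//; last 4 first.
- by move=> q; rewrite addr_ge0.
- by move=> q; rewrite addr_ge0.
- by apply: integrable_wrtD => //; [exact: integrable_jump|exact: integrable_rate].
- by apply: integrable_wrtD => //; [exact: integrable_jump|exact: integrable_rate].
by rewrite !weighted_sumD// !weighted_sum_jump// addeC subrr.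
Qed.

Lemma weighted_sum_drift_le V f b : (forall q, 0 <= V q) ->
  (forall q, 0 <= f q) -> 0 <= b -> (forall q, gen V q <= b - f q) ->
  (weighted_sum pi f <= b%:E)%E.
Proof.
(* [V] need not be integrable, but its truncation [g] is bounded and has drift
   at most [b - f] where [V <= n], and at most 0 elsewhere. *)
move=> V0 f0 b0 drift; apply: ge_ereal_sup => _ [X [finX _] <-].
(* This level makes the truncation inactive on the finite set [X], so that [h] agrees with [f]
   there. *)
pose n := \sum_(q <- fset_set X) V q.
have n0 : 0 <= n by exact: sumr_ge0.
have Vn q : q \in fset_set X -> V q <= n.
  by move=> qX; rewrite /n (big_fsetD1 q)//= lerDl sumr_ge0.
pose g q := Num.min (V q) n.
have g0 q : 0 <= g q by rewrite le_min V0 n0.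
have gn q : g q <= n by rewrite ge_min lexx orbT.
pose h q := (V q <= n)%R%:R * f q.
have h0 q : 0 <= h q by rewrite mulr_ge0.
have Rg0 q : 0 <= total_rate q * g q by rewrite mulr_ge0// total_rate_ge0.
have Ig : integrable_wrt pi g.
  by apply: (integrable_wrt_bounded pi_ge0 pi_total (B := n)) => // q; rewrite ger0_norm.
have key q : jump g q + h q <= total_rate q * g q + b.
  rewrite /h; have [Vq|Vq] := leP (V q) n.
    rewrite mul1r /g (min_l Vq).
    have := drift q; rewrite /gen => d.
    have : jump g q <= jump V q.
      by apply: le_jump => x; rewrite ge_min lexx.
    rewrite /g; lra.
  rewrite mul0r addr0 /g (min_r (ltW Vq)) -jump_cst.
  by rewrite (le_trans (le_jump _ gn))// lerDl.
have : (weighted_sum pi (fun q => (jump g q + h q)%R) <=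
    weighted_sum pi (fun q => (total_rate q * g q + b)%R))%E.
  exact: le_weighted_sum.
rewrite !weighted_sumD//; last by move=> q; rewrite jump_ge0.
(* The common term can be cancelled because it is finite: [g] is bounded, whereas [V] might have
   infinite mean. *)
rewrite weighted_sum_jump// leeD2lE; last first.
  by apply: weighted_sum_fin => //; exact: integrable_rate.
have -> : weighted_sum pi (fun=> b) = b%:E.
  rewrite -mean_ge0E// meanE ?rmean_cst//.
  by apply: (integrable_wrt_bounded pi_ge0 pi_total (B := `|b|)).
apply: le_trans; apply: esum_ge; exists X; first by split.
rewrite !fsbig_finite//= big_seq [leRHS]big_seq.
by apply: lee_sum => q /Vn Vq; rewrite /h Vq mul1r.
Qed.

End Stationary.
End Chain.

(** By compactness of the segment the image ultrafilter has a cluster point, and an ultrafilter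
    converges to each of its cluster points. *)
Lemma ultra_bounded_cvg (R : realType) (U : set_system nat) (u : nat -> R) a b :
  UltraFilter U -> (forall n, a <= u n <= b) -> exists l : R, u @ U --> l.
Proof.
move=> UU uab.
have : (u @ U) `[a, b]%classic.
  by apply: (@filterE _ U) => n; rewrite /= in_itv /=; exact: uab.
have FF : ProperFilter (u @ U) by exact: fmap_proper_filter.
move=> /(@segment_compact R a b _ FF) [l [_ cl]]; exists l => A lA.
have [//|UA] := in_ultra_setVsetC (u @^-1` A) UU.
by have [x [/= nAx Ax]] := cl (~` A) A UA lA.
Qed.

(** * Existence of a stationary distribution from a drift condition *)

Section Existence.
Variables (R : realType) (S : choiceType) (I : finType).
Variables (w : S -> I -> R) (tgt : S -> I -> S).
Implicit Types (f g V : S -> R) (b c : R).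
Hypothesis w_ge0 : forall q e, 0 <= w q e.
Variable L : R.
Hypothesis L_gt0 : 0 < L.
Hypothesis rate_le : forall q, total_rate w q <= L.
Variable q0 : S.

(* [step] is the transition operator of the chain uniformized at rate [L]; a
   stationary distribution is obtained as an ultrafilter limit of the averages
   [avg n] of its iterates at [q0]. *)
Let step f q := f q + gen w tgt f q / L.
Let law k f := iter k step f q0.
Let avg n f := (\sum_(k < n.+1) law k f) / n.+1%:R.

Let stepP c f g :
  step (fun q => c * f q + g q) = fun q => c * step f q + step g q.
Proof.
apply/funext => q; rewrite /step /gen jumpD jumpZ; ring.
Qed.

Let lawP k c f g : law k (fun q => c * f q + g q) = c * law k f + law k g.
Proof. by rewrite /law; elim: k f g => // k IH f g; rewrite !iterSr stepP IH. Qed.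

(** Positivity of the uniformized operator: [L] dominates every total rate, so the weight
    [1 - total_rate w q / L] of staying put is nonnegative. *)
Let le_step f g : (forall q, f q <= g q) -> forall q, step f q <= step g q.
Proof.
move=> fg q; rewrite /step /gen !mulrBl !addrA.
have rL : 0 <= 1 - total_rate w q / L.
  by rewrite subr_ge0 ler_pdivrMr// mul1r.
have := ler_wpM2l rL (fg q).
have : jump w tgt f q / L <= jump w tgt g q / L.
  by rewrite ler_pM2r ?invr_gt0// le_jump.
rewrite !mulrBl !mul1r [_ * f q / L]mulrAC [_ * g q / L]mulrAC; lra.
Qed.

Let le_law k f g : (forall q, f q <= g q) -> law k f <= law k g.
Proof.
rewrite /law => fg; elim: k f g fg => [//|k IH] f g fg; rewrite !iterSr.
by apply: IH; exact: le_step.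
Qed.

Let law_cst k c : law k (fun=> c) = c.
Proof.
rewrite /law; elim: k => // k; rewrite iterSr (_ : step _ = fun=> c)//.
by apply/funext => q; rewrite /step /gen jump_cst subrr mul0r addr0.
Qed.

Let avgP n c f g : avg n (fun q => c * f q + g q) = c * avg n f + avg n g.
Proof.
rewrite /avg (eq_bigr _ (fun (k : 'I_n.+1) _ => lawP k c f g)) big_split /=.
by rewrite -mulr_sumr mulrDl mulrA.
Qed.

Let le_avg n f g : (forall q, f q <= g q) -> avg n f <= avg n g.
Proof.
move=> fg; rewrite ler_pM2r ?invr_gt0 ?ltr0n//.
by apply: ler_sum => k _; exact: le_law.
Qed.

Let avg_cst n c : avg n (fun=> c) = c.
Proof.
rewrite /avg (eq_bigr _ (fun (k : 'I_n.+1) _ => law_cst k c)) sumr_const card_ord.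
by rewrite -[_ *+ _]mulr_natr mulfK// pnatr_eq0.
Qed.

Let avg_sum n (X : seq S) (d : S -> R) (F : S -> S -> R) :
  avg n (fun q => \sum_(x <- X) d x * F x q) = \sum_(x <- X) d x * avg n (F x).
Proof.
elim: X => [|x X IH].
  rewrite big_nil (_ : (fun q => _) = fun=> 0) ?avg_cst//.
  by apply/funext => q; rewrite big_nil.
rewrite big_cons -IH -avgP; congr avg; apply/funext => q.
by rewrite big_cons.
Qed.

(** The sum telescopes, so the averages are invariant up to an error of order [1 / n]. *)
Let avg_step n f : avg n (step f) - avg n f = (law n.+1 f - f q0) / n.+1%:R.
Proof.
rewrite /avg -mulrBl; congr (_ / _); rewrite -sumrB.
rewrite (eq_bigr (fun k : 'I_n.+1 => law k.+1 f - law k f)); last first.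
  by move=> k _; rewrite /law iterSr.
by rewrite -(big_mkord xpredT (fun k => law k.+1 f - law k f)) telescope_sumr.
Qed.

Variables (V f : S -> R) (b : R).
Hypothesis V_ge0 : forall q, 0 <= V q.
Hypothesis f_ge0 : forall q, 0 <= f q.
Hypothesis drift : forall q, gen w tgt V q <= b - f q.
Hypothesis sublevel_finite : forall c, finite_set [set q | f q <= c].
Hypothesis source_finite : forall q, finite_set [set x | exists e, tgt x e = q].

(** The drift inequality, averaged along the iterates, telescopes in [V], and [V] is nonnegative.
    The bound is uniform in [n]; as [f] has finite sublevel sets, it expresses tightness. *)
Let avg_drift_le n : avg n f <= b + L * V q0.
Proof.
have h1 : avg n (step V) <= avg n (fun q => (- L^-1) * f q + (V q + b / L)).
  apply: le_avg => q; rewrite /step.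
  have : gen w tgt V q / L <= (b - f q) / L by rewrite ler_pM2r ?invr_gt0.
  rewrite mulrBl mulNr [_^-1 * _]mulrC; lra.
rewrite avgP in h1.
have h2 : avg n (fun q => V q + b / L) = avg n V + b / L.
  rewrite -[avg n V]mul1r -[X in _ + X](avg_cst n) -avgP.
  by congr avg; apply/funext => q; rewrite mul1r.
have h3 := avg_step n V.
have h4 : 0 <= law n.+1 V.
  by rewrite -[leLHS](law_cst n.+1 0) le_law.
have h5 : - V q0 <= (law n.+1 V - V q0) / n.+1%:R.
  rewrite ler_pdivlMr ?ltr0n//; rewrite mulNr.
  have : V q0 * 1 <= V q0 * n.+1%:R by rewrite ler_wpM2l// ler1n.
  rewrite mulr1; lra.
rewrite h2 in h1.
have h6 : avg n f / L <= b / L + V q0.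
  rewrite [avg n f / L]mulrC; move: h1 h3 h5.
  by set y := _ / n.+1%:R; clearbody y; lra.
have : avg n f / L * L <= (b / L + V q0) * L by rewrite ler_pM2r.
by rewrite mulrDl !divfK ?gt_eqF// [V q0 * L]mulrC.
Qed.

Let ind (x q : S) : R := (x == q)%:R.

Let sum_ind (X : {fset S}) (d : S -> R) q :
  \sum_(x <- X) d x * ind x q = if q \in X then d q else 0.
Proof.
case: ifPn => qX.
  rewrite (big_fsetD1 q)//= /ind eqxx mulr1 big_seq big1 ?addr0// => x.
  by rewrite !inE => /andP[/negbTE -> _]; rewrite mulr0.
rewrite big_seq big1// => x xX; rewrite /ind.
by case: eqP xX qX => [->|_ _ _]; [move=> ->|rewrite mulr0].
Qed.

(** Krylov-Bogoliubov argument: tightness prevents the limit from losing mass, and balance at [q']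
    involves only finitely many source states, so it passes to the limit. *)
Lemma stationary_exists : exists pi, is_stationary w tgt pi.
Proof.
have [U [UU ooU]] := ultraFilterLemma (eventually_filter : ProperFilter \oo).
have avg_ind01 x n : 0 <= avg n (ind x) <= 1.
  rewrite -[0](avg_cst n) -[X in _ <= _ <= X](avg_cst n 1).
  by apply/andP; split; apply: le_avg => q; rewrite /ind; case: eqP.
have [pi piP] := choice (fun x => ultra_bounded_cvg UU (avg_ind01 x)).
have pi_ge0 x : 0 <= pi x.
  apply: (cvgr_to_ge (piP x)); apply: nearW => n.
  by have /andP[] := avg_ind01 x n.
have cvg_avg (X : {fset S}) (d : S -> R) :
    avg n (fun q => \sum_(x <- X) d x * ind x q) @[n --> U] -->
      \sum_(x <- X) d x * pi x.
  rewrite (_ : (fun n => _) = fun n => \sum_(x <- X) d x * avg n (ind x)).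
    elim: (X : seq S) => [|x s IH].
      rewrite big_nil (_ : (fun n => _) = fun=> 0); first exact: cvg_cst.
      by apply/funext => n; rewrite big_nil.
    rewrite big_cons (_ : (fun n => _) = fun n => d x * avg n (ind x) +
      \sum_(x <- s) d x * avg n (ind x)).
      by apply: cvgD IH; apply: cvgMl_tmp; exact: piP.
    by apply/funext => n; rewrite big_cons.
  by apply/funext => n; rewrite avg_sum.
exists pi; split => //.
  apply/eqP; rewrite eq_le; apply/andP; split.
    apply: ge_ereal_sup => _ [X [finX _] <-].
    rewrite fsbig_finite//= sumEFin lee_fin.
    have := cvg_avg (fset_set X) (fun=> 1).
    under eq_bigr do rewrite mul1r.
    move=> /cvgr_to_le; apply; apply: nearW => n.
    rewrite -[leRHS](avg_cst n); apply: le_avg => q.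
    by rewrite sum_ind; case: ifP.
  apply/lee_addgt0Pr => e e0.
  pose B := b + L * V q0.
  have B0 : 0 <= B.
    by apply: le_trans (avg_drift_le 0); rewrite -(avg_cst 0 0) le_avg.
  (* By Markov's inequality the averages put mass at most [B / c <= e] outside the sublevel set of
     [f] at [c]; the [+ 1] keeps [c] positive when [B] is 0. *)
  pose c := (B + 1) / e.
  have c0 : 0 < c by rewrite divr_gt0// ltr_wpDl.
  pose X := fset_set [set q | f q <= c].
  have inX q : (q \in X) = (f q <= c).
    by rewrite /X in_fset_set// mem_setE.
  have : (1 - e <= \sum_(x <- X) pi x).
    have := cvg_avg X (fun=> 1).
    under eq_bigr do rewrite mul1r.
    move=> /cvgr_to_ge; apply; apply: nearW => n.
    apply: (@le_trans _ _ (avg n (fun q => (- c^-1) * f q + 1))).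
      rewrite avgP avg_cst mulNr [leRHS]addrC lerD2l lerN2 mulrC ler_pdivrMr//.
      apply: le_trans (avg_drift_le n) _; rewrite -/B /c mulrC divfK ?gt_eqF//.
      by rewrite lerDl.
    apply: le_avg => q; rewrite sum_ind inX mulNr mulrC; case: ifPn => [_|].
      by rewrite gerDr oppr_le0 divr_ge0// ltW.
    by rewrite -ltNge => cf; rewrite addrC subr_le0 ler_pdivlMr// mul1r ltW.
  rewrite lerBlDr -lee_fin => /le_trans; apply.
  rewrite EFinD leeD2r//; apply: esum_ge; exists [set` X]; first by split.
  by rewrite fsbig_finite//= set_fsetK sumEFin.
move=> q'.
(* Outside [X] the generator kills the indicator of [q']: neither inflow to [q'] nor outflow from it
   occurs. Hence its image is a finite combination of indicators, to which [cvg_avg] applies. *)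
pose X := (fset_set [set x | exists e, tgt x e = q'] `|` [fset q'])%fset.
have jump0 x : x \notin X -> jump w tgt (ind q') x = 0.
  rewrite in_fsetU negb_or in_fset_set// => /andP[/negP nx _].
  apply: big1 => e _; rewrite /ind; case: eqP => [qe|_]; last by rewrite mulr0.
  by exfalso; apply: nx; apply: mem_set; exists e.
have := cvg_avg X (gen w tgt (ind q')).
have -> : (fun q => \sum_(x <- X) gen w tgt (ind q') x * ind x q) =
    gen w tgt (ind q').
  apply/funext => q; rewrite sum_ind; case: ifPn => // qX.
  rewrite /gen jump0// /ind; case: eqP => [qq|_]; last by rewrite mulr0 subr0.
  by move: qX; rewrite -qq in_fsetU in_fset1 eqxx orbT.
have avg_gen n : avg n (gen w tgt (ind q')) =
    L * ((law n.+1 (ind q') - ind q' q0) / n.+1%:R).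
  rewrite -avg_step.
  have -> : step (ind q') = fun q => L^-1 * gen w tgt (ind q') q + ind q' q.
    by apply/funext => q; rewrite /step addrC mulrC.
  by rewrite avgP addrK mulrA mulfV ?gt_eqF// mul1r.
have cvg0 : avg n (gen w tgt (ind q')) @[n --> U] --> (0 : R).
  have : avg n (gen w tgt (ind q')) @[n --> \oo] --> (0 : R).
    apply: (@squeeze_cvgr _ _ _ _ (fun n => - (L * harmonic n))
      (fun n => L * harmonic n)).
    - apply: nearW => n; rewrite -ler_norml avg_gen normrM gtr0_norm//.
      rewrite ler_pM2l// normrM /harmonic /= [ `|_^-1| ]gtr0_norm ?invr_gt0//.
      rewrite -[leRHS]mul1r ler_pM2r ?invr_gt0//.
      have : law n.+1 (ind q') <= 1.
        by rewrite -[leRHS](law_cst n.+1) le_law// => q; rewrite /ind; case: eqP.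
      have : 0 <= law n.+1 (ind q').
        by rewrite -[leLHS](law_cst n.+1) le_law// => q; rewrite /ind; case: eqP.
      rewrite /ind ler_norml; case: eqP => _ /= h1 h2; apply/andP; split; lra.
    - rewrite -oppr0 -(mulr0 L); apply: cvgN; apply: cvgMl_tmp; exact: cvg_harmonic.
    - rewrite -(mulr0 L); apply: cvgMl_tmp; exact: cvg_harmonic.
  by move=> h A /h; exact: ooU.
move=> /(cvg_unique _ cvg0) => /(_ (@Rhausdorff R)) sum0.
rewrite (@esum_fset_support _ _ X); last 2 first.
- by move=> x; rewrite lee_fin mulr_ge0// jump_ge0.
- by move=> x xX; rewrite jump0// mulr0.
rewrite sumEFin; congr EFin.
have <- : \sum_(x <- X) (pi x * total_rate w x) * ind x q' =
    pi q' * total_rate w q'.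
  by rewrite sum_ind in_fsetU in_fset1 eqxx orbT.
apply/eqP; rewrite -subr_eq0 -sumrB; apply/eqP; rewrite [RHS]sum0; apply: eq_bigr => x _.
by rewrite /gen -/(ind q') /ind [x == q']eq_sym; ring.
Qed.

End Existence.

(** * Calculus on intervals *)

Section Calculus.
Variable R : realType.
Implicit Types (D : set R) (f : R -> R) (x y a b : R).

Lemma derivative_on_linear_approx D f f1 x e : derivative_on D f f1 -> D x ->
  0 < e -> exists2 d, 0 < d & forall y, `|y - x| < d -> D y ->
    `|f y - f x - f1 x * (y - x)| <= e * `|y - x|.
Proof.
move=> df Dx e0.
have /cvgrPdist_lt /(_ e e0) := df x Dx.
rewrite near_withinE => /nbhs_ballP [d /= d0 dP].
exists d => // y yd Dy.
have [->|yx] := eqVneq y x; first by rewrite !subrr mulr0 subr0 normr0 mulr0.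
have xy0 : y - x != 0 by rewrite subr_eq0.
have := dP y; rewrite /ball /= distrC => /(_ yd yx Dy) /ltW.
rewrite -(ler_pM2r (x := `|y - x|)) ?normr_gt0// -normrM mulrBl divfK//.
by rewrite distrC.
Qed.

Lemma derivative_on_is_derive D f f1 x : derivative_on D f f1 ->
  nbhs x D -> is_derive x 1 f (f1 x).
Proof.
move=> df nD; have Dx := nbhs_singleton nD.
suff h : h^-1 *: (f (h *: 1 + x) - f x) @[h --> 0^'] --> f1 x.
  by apply: DeriveDef; [apply/cvg_ex; exists (f1 x)|exact: cvg_lim].
apply/cvgrPdist_le => e e0.
have [d d0 dP] := derivative_on_linear_approx df Dx e0.
move/nbhs_ballP : nD => [d' /= d'0 d'P].
apply/nbhs_ballP; exists (Num.min d d') => /=; first by rewrite lt_min d0.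
move=> h; rewrite /ball /= sub0r normrN lt_min => /andP[hd hd'] h0.
have := dP (h + x); rewrite addrK => /(_ hd).
have Dhx : D (h + x) by apply: d'P; rewrite /ball /= opprD addrCA subrr addr0 normrN.
move=> /(_ Dhx) ineq.
rewrite -(ler_pM2r (x := `|h|)) ?normr_gt0// -normrM.
rewrite [h *: 1]mulr1 /= mulrBl [h^-1 *: _ * h]mulrAC mulVf// mul1r.
by rewrite distrC.
Qed.

Lemma derivative_on_continuous D f f1 a b : derivative_on D f f1 ->
  (forall x, a <= x <= b -> D x) -> {within `[a, b], continuous f}.
Proof.
move=> df sub; apply/subspace_continuousP => x /= xab.
rewrite in_itv /= in xab.
have Dx := sub _ xab.
have [d d0 dP] := derivative_on_linear_approx df Dx ltr01.
apply/cvgrPdist_le => e e0; rewrite near_withinE.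
pose c := `|f1 x| + 1; have c0 : 0 < c by rewrite ltr_wpDl.
apply/nbhs_ballP; exists (Num.min d (e / c)) => /=.
  by rewrite lt_min d0 divr_gt0.
move=> y; rewrite /ball /= lt_min distrC => /andP[yd ye].
rewrite in_itv /= => /sub Dy; have := dP y yd Dy.
rewrite mul1r => h.
rewrite distrC -[f y - f x](subrK (f1 x * (y - x))).
apply: le_trans (ler_normD _ _) _; rewrite normrM.
move: ye; rewrite ltr_pdivlMr// /c => ye.
apply: le_trans (ltW ye).
rewrite [leRHS]mulrDr mulr1 [leRHS]addrC (mulrC `|y - x|).
by rewrite lerD2r.
Qed.

Lemma derivative_on_MVT D f f1 a b : derivative_on D f f1 -> a < b ->
  (forall x, a <= x <= b -> D x) ->
  exists2 c, a < c < b & f b - f a = f1 c * (b - a).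
Proof.
move=> df ab sub; have [||c] := @MVT R f f1 a b ab.
- move=> x; rewrite in_itv /= => /andP[ax xb].
  apply: (derivative_on_is_derive df); apply/nbhs_ballP.
  exists (Num.min (x - a) (b - x)) => /=; first by rewrite lt_min !subr_gt0 ax.
  move=> y; rewrite /ball /= lt_min ltr_norml => /andP[/andP[h1 h2] h3].
  by apply: sub; move: h3; rewrite ltr_norml => /andP[h3 h4]; apply/andP; split; lra.
- exact: derivative_on_continuous df sub.
by rewrite in_itv /= => cab ->; exists c.
Qed.

(** [r] is the marginal value at [x]. The radius [d] also certifies that perturbed rates stay in the
    feasible range. *)
Definition quadratic_approx (D : set R) (f : R -> R) (x r C d : R) : Prop :=
  [/\ 0 <= C, 0 < d & forall h, `|h| < d -> D (x + h) /\
    `|f (x + h) - f x - r * h| <= C * h ^+ 2].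

(** The mean value theorem writes the error as [(f1 (x + c) - f1 x) * h] with [c] no larger than [h]
    in absolute value; differentiability of [f1] at the single point [x] bounds the first factor
    linearly in [c]. *)
Lemma second_derivative_on_quadratic_approx D f f2 x :
  second_derivative_on D f f2 -> D^° x ->
  exists r C d, quadratic_approx D f x r C d.
Proof.
move=> [f1 df df1] /nbhs_ballP [d1 /= d10 d1P].
have Dx : D x by apply: d1P; exact: ballxx.
have [d d0 dP] := derivative_on_linear_approx df1 Dx ltr01.
exists (f1 x), (`|f2 x| + 1), (Num.min d d1).
have C0 : 0 <= `|f2 x| + 1 by rewrite addr_ge0.
split => //; first by rewrite lt_min d0.
have inD h : `|h| < d1 -> D (x + h).
  by move=> hd; apply: d1P; rewrite /ball /= opprD addrA subrr sub0r normrN.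
move=> h; rewrite lt_min => /andP[hd hd1]; split; first exact: inD.
suff [c cx cE] : exists2 c, `|c| <= `|h| & f (x + h) - f x = f1 (x + c) * h.
  have := dP (x + c); rewrite addrAC subrr add0r => /(_ (le_lt_trans cx hd)).
  move=> /(_ (inD _ (le_lt_trans cx hd1))); rewrite mul1r => h1.
  have h2 : `|f1 (x + c) - f1 x| <= (`|f2 x| + 1) * `|c|.
    rewrite -[f1 (x + c) - f1 x](subrK (f2 x * c)) addrC.
    by rewrite (le_trans (ler_normD _ _))// normrM mulrDl mul1r lerD2l.
  rewrite cE -mulrBl normrM -(real_normK (num_real h)) expr2 mulrA ler_wpM2r//.
  by rewrite (le_trans h2)// ler_wpM2l.
have [h0|h0|->] := ltgtP h 0; last by exists 0; rewrite // addr0 subrr mulr0.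
- have [||c /andP[c1 c2] cE] := derivative_on_MVT (a := x + h) (b := x) df.
  + by rewrite gtrDl.
  + move=> y /andP[y1 y2]; rewrite -[y](subrKC x); apply: inD.
    apply: le_lt_trans hd1; rewrite (ltr0_norm h0) ler0_norm; lra.
  exists (c - x); first by rewrite (ltr0_norm h0) ler0_norm; lra.
  by rewrite subrKC -opprB cE; ring.
- have [||c /andP[c1 c2] cE] := derivative_on_MVT (a := x) (b := x + h) df.
  + by rewrite ltrDl.
  + move=> y /andP[y1 y2]; rewrite -[y](subrKC x); apply: inD.
    apply: le_lt_trans hd1; rewrite (gtr0_norm h0) ger0_norm; lra.
  exists (c - x); first by rewrite (gtr0_norm h0) ger0_norm; lra.
  by rewrite subrKC cE; ring.
Qed.

Lemma derivative_onN D f f1 : derivative_on D f f1 ->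
  derivative_on D (fun x => - f x) (fun x => - f1 x).
Proof.
move=> df x Dx; rewrite (_ : (fun y => _) = fun y => - ((f y - f x) / (y - x))).
  exact: cvgN (df x Dx).
by apply/funext => y; rewrite -mulNr opprD.
Qed.

(** The mean value theorem on each half gives two slopes; applied to [f1] between the two
    intermediate points, it shows that the right slope is smaller. *)
Lemma midpoint_strict_concave D f f2 x y : is_interval D ->
  second_derivative_on D f f2 -> (forall z, D z -> f2 z < 0) ->
  D x -> D y -> x != y -> (f x + f y) / 2 < f ((x + y) / 2).
Proof.
move=> iD [f1 df df1] neg; wlog xy : x y / x < y => [hw Dx Dy xney|Dx Dy _].
  have [xy|yx|xy] := ltgtP x y; first exact: hw.
    by rewrite [f x + _]addrC [x + _]addrC; apply: hw => //; rewrite eq_sym.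
  by rewrite xy eqxx in xney.
have sub z : x <= z <= y -> D z by exact: iD.
pose m := (x + y) / 2.
have mE : m = x / 2 + y / 2 by rewrite /m mulrDl.
have [|z /andP[? ?]|c /andP[? ?] cE] := derivative_on_MVT (a := x) (b := m) df.
- lra.
- apply: sub; apply/andP; split; lra.
have [|z /andP[? ?]|c' /andP[? ?] c'E] := derivative_on_MVT (a := m) (b := y) df.
- lra.
- apply: sub; apply/andP; split; lra.
have [|z /andP[? ?]|c2 /andP[? ?] c2E] := derivative_on_MVT (a := c) (b := c') df1.
- by lra.
- by apply: sub; apply/andP; split; lra.
have : f2 c2 * (c' - c) < 0.
  by rewrite pmulr_llt0; [apply: neg; apply: sub; apply/andP; split; lra|lra].
rewrite -c2E subr_lt0 => c'c.
have : f1 c' * (y - m) < f1 c * (m - x).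
  rewrite (_ : m - x = y - m); last by lra.
  by rewrite ltr_pM2r//; lra.
rewrite -cE -c'E -/m; lra.
Qed.

End Calculus.

(** * The fluid problem *)

Lemma sumr_le0_eq0 (R : realDomainType) (T : finType) (F : T -> R) :
  (forall t, 0 <= F t) -> \sum_t F t <= 0 -> forall t, F t = 0.
Proof.
move=> F0 s0 t; apply/eqP; move: s0; rewrite le_eqVlt ltNge sumr_ge0// orbF.
by rewrite psumr_eq0// => /allP /(_ t); rewrite mem_index_enum; apply.
Qed.

Lemma sum_perturb1 (R : pzRingType) (T : finType) (F : T -> R -> R)
    (x : T -> R) (s : R) (t : T) :
  \sum_u F u (x u + s * (u == t)%:R) =
  \sum_u F u (x u) + (F t (x t + s) - F t (x t)).
Proof.
rewrite (bigD1 t)//= [in RHS](bigD1 t)//= eqxx mulr1 addrC [in RHS]addrAC subrKC.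
rewrite addrC; congr (_ + _); apply: eq_bigr => u /negbTE ->.
by rewrite mulr0 addr0.
Qed.

Section Fluid.
Variables (R : realType) (N M : finType) (K : market R N M).
Hypothesis hK : market_assumptions K.
Variables (lams : M -> R) (mus : N -> R) (chis : N -> M -> R).
Hypothesis hopt : fluid_optimal K lams mus chis.

Let rev j x := x * demand K j x.
Let cost i x := x * supply K i x.
Let A := (compat K :\: redundant K)%SET.

Let interval_mid (D : interval R) x y :
  x \in D -> y \in D -> (x + y) / 2 \in D.
Proof.
move=> xD yD; wlog xy : x y xD yD / x <= y => [hw|].
  by have [xy|/ltW yx] := leP x y; [exact: hw|rewrite addrC; exact: hw].
apply: (@interval_is_interval R D x y) => //.
by apply/andP; split; rewrite ?ler_pdivlMr ?ler_pdivrMr ?ltr0n//; lra.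
Qed.

Let avgE (x : R) : (x + x) / 2 = x.
Proof. lra. Qed.

Let rev_mid j x y : x \in cust_range K j -> y \in cust_range K j ->
  0 <= rev j ((x + y) / 2) - (rev j x + rev j y) / 2 ?= iff (x == y).
Proof.
move=> xD yD; have [/(_ j) [_ _ _ _ [f2 df2 f2n]] _] := hK.
have [<-|xy] := eqVneq x y.
  by rewrite !avgE subrr; exact/leif_refl.
apply/leifP; rewrite subr_gt0.
exact: (midpoint_strict_concave (@interval_is_interval R _) df2 f2n).
Qed.

Let cost_mid i x y : x \in serv_range K i -> y \in serv_range K i ->
  0 <= (cost i x + cost i y) / 2 - cost i ((x + y) / 2) ?= iff (x == y).
Proof.
move=> xD yD; have [_ [/(_ i) [_ _ _ _ [f2 [f1 df df1] f2n]]] _] := hK.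
have [<-|xy] := eqVneq x y.
  by rewrite !avgE subrr; exact/leif_refl.
apply/leifP; rewrite subr_gt0.
have := @midpoint_strict_concave R [set` serv_range K i] (fun x => - cost i x)
  (fun x => - f2 x) x y (@interval_is_interval R _).
move=> /(_ _ _ xD yD xy); rewrite -opprD mulNr ltrN2; apply.
  by exists (fun x => - f1 x); exact: derivative_onN.
by move=> z /f2n; rewrite oppr_lt0.
Qed.

Lemma fluid_optimal_unique lam mu chi : fluid_optimal K lam mu chi ->
  (forall j, lam j = lams j) /\ (forall i, mu i = mus i).
Proof.
move=> [feas opt]; have [feas' opt'] := hopt.
have [lr mr lE mE pos] := feas; have [lr' mr' lE' mE' pos'] := feas'.
pose lam2 j := (lam j + lams j) / 2; pose mu2 i := (mu i + mus i) / 2.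
have feas2 : fluid_feasible K lam2 mu2 (fun i j => (chi i j + chis i j) / 2).
  split.
  - by move=> j; exact: interval_mid.
  - by move=> i; exact: interval_mid.
  - by move=> j; rewrite /lam2 lE lE' -big_split mulr_suml.
  - by move=> i; rewrite /mu2 mE mE' -big_split mulr_suml.
  - move=> i j; have [h1 h2] := pos i j; have [h1' h2'] := pos' i j; split=> h.
      by rewrite divr_ge0 ?addr_ge0 ?h1 ?h1'.
    by rewrite h2// h2'// addr0 mul0r.
have := opt' _ _ _ feas2; have := opt _ _ _ feas'; rewrite /fluid_profit.
set r := \sum_j lams j * _; set c := \sum_i mus i * _.
set r' := \sum_j lam j * _; set c' := \sum_i mu i * _.
set r2 := \sum_j lam2 j * _; set c2 := \sum_i mu2 i * _ => o1 o2.
(* [gr] and [gc] are the gains made at the midpoint. They are nonnegative and optimality makes their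
   total at most 0, so each vanishes, and the equality case forces equal rates. The flows themselves
   may differ. *)
pose gr j := rev j (lam2 j) - (rev j (lam j) + rev j (lams j)) / 2.
pose gc i := (cost i (mu i) + cost i (mus i)) / 2 - cost i (mu2 i).
have gr0 j : 0 <= gr j by apply: (rev_mid (lr j) (lr' j)).1.
have gc0 i : 0 <= gc i by apply: (cost_mid (mr i) (mr' i)).1.
have grE : \sum_j gr j = r2 - (r' + r) / 2.
  by rewrite /gr sumrB -mulr_suml big_split.
have gcE : \sum_i gc i = (c' + c) / 2 - c2.
  by rewrite /gc sumrB -mulr_suml big_split.
have sr0 : 0 <= \sum_j gr j by exact: sumr_ge0.
have sc0 : 0 <= \sum_i gc i by exact: sumr_ge0.
have o3 : r' - c' <= r - c by exact: opt' feas.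
split=> [j|i].
  have /eqP : gr j = 0 by apply: sumr_le0_eq0 => //; lra.
  by rewrite eq_sym (rev_mid (lr j) (lr' j)).2 => /eqP.
have /eqP : gc i = 0 by apply: sumr_le0_eq0 => //; lra.
by rewrite eq_sym (cost_mid (mr i) (mr' i)).2 => /eqP.
Qed.

Lemma redundant_eq0 lam mu chi e : fluid_optimal K lam mu chi ->
  e \notin A -> chi e.1 e.2 = 0.
Proof.
move=> opt; rewrite finset.in_setD negb_and negbK => /orP[|eE].
  by rewrite inE => /andP[_ /asboolP]; apply; exact: opt.
have [[_ _ _ _ /(_ e.1 e.2) [_ h]] _] := opt.
by apply: h; rewrite -surjective_pairing.
Qed.

Lemma fluid_optimal_positive : exists chi,
  fluid_optimal K lams mus chi /\
  forall i j, (i, j) \in A -> 0 < chi i j.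
Proof.
have /choice [X XP] : forall e : N * M, exists chi,
    fluid_optimal K lams mus chi /\ (e \in A -> 0 < chi e.1 e.2).
  move=> e; have [eA|_] := boolP (e \in A); last by exists chis.
  have := eA; rewrite finset.in_setD inE => /andP[/nandP[/negP//|/asboolP ne] eE].
  have [lam [mu [chi [opt nz]]]] : exists lam mu chi,
      fluid_optimal K lam mu chi /\ chi e.1 e.2 != 0.
    apply: contrapT => h; apply: ne => lam mu chi opt; apply/eqP/negPn/negP => nz.
    by apply: h; exists lam, mu, chi.
  (* Nonredundancy supplies an optimal solution with rates of its own; uniqueness identifies them
     with [lams] and [mus], so that flows can be averaged at fixed rates. *)
  exists chi; have [lE mE] := fluid_optimal_unique opt.
  have <- : lam = lams by exact/funext.
  have <- : mu = mus by exact/funext.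
  split=> // _; rewrite lt_neqAle eq_sym nz.
  have [[_ _ _ _ /(_ e.1 e.2) [h _]] _] := opt.
  by apply: h; rewrite -surjective_pairing.
(* Average [chis] and the flows [X e], each positive on the edge [e]. *)
pose c : R := (#|{: N * M}|.+1)%:R.
have c0 : 0 < c by rewrite ltr0n.
pose chi i j := (chis i j + \sum_e X e i j) / c.
have cE (x : R) : (x + \sum_(e : N * M) x) / c = x.
  rewrite sumr_const -[X in X + _]mulr1n -mulrnDr -[_ *+ _]mulr_natr.
  by rewrite mulfK// gt_eqF.
have [[lr mr lE mE pos] opt] := hopt.
exists chi; split.
  split; last exact: opt.
  split=> // [j|i|i j].
  - rewrite -[LHS]cE /chi -mulr_suml big_split exchange_big /= -lE.
    congr ((_ + _) / _); apply: eq_bigr => e _.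
    by have [[[_ _ lE' _ _] _] _] := XP e.
  - rewrite -[LHS]cE /chi -mulr_suml big_split exchange_big /= -mE.
    congr ((_ + _) / _); apply: eq_bigr => e _.
    by have [[[_ _ _ mE' _] _] _] := XP e.
  - split=> ij; rewrite /chi.
      rewrite divr_ge0 ?(ltW c0)// addr_ge0 ?(pos i j).1//; apply: sumr_ge0 => e _.
      by have [[[_ _ _ _ /(_ i j) [h _]] _] _] := XP e; exact: h.
    rewrite (pos i j).2// big1 ?addr0 ?mul0r// => e _.
    by have [[[_ _ _ _ /(_ i j) [_ h]] _] _] := XP e; exact: h.
move=> i j ijA; have ijE : (i, j) \in compat K.
  by move: ijA; rewrite finset.in_setD => /andP[].
rewrite /chi divr_gt0// ltr_wpDl ?(pos i j).1//.
rewrite (bigD1 (i, j))//= ltr_pwDl//; first by have [_ /(_ ijA)] := XP (i, j).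
apply: sumr_ge0 => e _.
by have [[[_ _ _ _ /(_ i j) [h _]] _] _] := XP e; exact: h.
Qed.

(** If [a = r - r'] were nonzero, shifting the flow on the edge by [t = a * s] would gain at least
    [a ^+ 2 * s * (1 - B * s)], positive for small [s]. As [a] may be negative, the flow on the edge
    must be positive. *)
Lemma marginal_revenue_eq_cost i j r C d r' C' d' : (i, j) \in A ->
  quadratic_approx [set` cust_range K j] (rev j) (lams j) r C d ->
  quadratic_approx [set` serv_range K i] (cost i) (mus i) r' C' d' ->
  r = r'.
Proof.
move=> ijA [C0 d0 rP] [C'0 d'0 cP]; apply/eqP/negPn/negP => rr.
have [chi [opt chi_pos]] := fluid_optimal_positive.
have [[lr mr lE mE pos] op] := opt.
pose a := r - r'; have a0 : 0 < `|a| by rewrite normr_gt0 subr_eq0.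
(* Any [t] below [D] in absolute value keeps the flow nonnegative and both rates within reach of the
   quadratic approximations. *)
pose D := Num.min (chi i j) (Num.min d d').
have D0 : 0 < D by rewrite !lt_min chi_pos// d0.
pose B := C + C'; have B0 : 0 <= B by rewrite addr_ge0.
have BD : 0 < 1 + B * D by rewrite ltr_wpDr ?mulr_ge0// ltW.
(* The first factor of the denominator ensures that [a * s] is below [D] in absolute value, the
   second that [B * s < 1]. *)
pose s := D / ((`|a| + 1) * (1 + B * D)).
have s0 : 0 < s by rewrite divr_gt0// mulr_gt0// addr_gt0.
have sE : s * (`|a| + 1) * (1 + B * D) = D.
  by rewrite -mulrA divfK// gt_eqF// mulr_gt0// addr_gt0.
have as_small : `|a * s| < D.
  rewrite normrM (gtr0_norm s0).
  apply: (@lt_le_trans _ _ (s * (`|a| + 1))); first by rewrite mulrDr mulr1 mulrC ltrDl.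
  have y0 : 0 <= s * (`|a| + 1) by rewrite mulr_ge0 ?addr_ge0// ltW.
  have x1 : 1 <= 1 + B * D by rewrite lerDl mulr_ge0// ltW.
  by rewrite -[leRHS]sE; exact: ler_peMr.
have Bs : B * s < 1.
  have h : s * (1 + B * D) <= D.
    apply: (@le_trans _ _ (s * (1 + B * D) * (`|a| + 1))).
      by apply: ler_peMr; rewrite ?lerDr// mulr_ge0 ?(ltW BD) ?(ltW s0).
    by rewrite mulrAC sE.
  have : s * (B * D) < D by apply: lt_le_trans h; rewrite mulrDr mulr1 ltrDr.
  by rewrite mulrA -[ltRHS]mul1r ltr_pM2r// mulrC.
move: as_small; rewrite !lt_min => /and3P[h1 h2 h3].
pose t := a * s.
have [inD1 q1] := rP t h2; have [inD2 q2] := cP t h3.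
pose lam k := lams k + t * (k == j)%:R.
pose mu k := mus k + t * (k == i)%:R.
pose chi' k l := chi k l + t * ((k == i) && (l == j))%:R.
have feas : fluid_feasible K lam mu chi'.
  split.
  - move=> k; rewrite /lam; have [->|_] := eqVneq k j; first by rewrite mulr1.
    by rewrite mulr0 addr0.
  - move=> k; rewrite /mu; have [->|_] := eqVneq k i; first by rewrite mulr1.
    by rewrite mulr0 addr0.
  - move=> l; rewrite /lam /chi' big_split /= -lE -mulr_sumr.
    congr (_ + _ * _); rewrite (bigD1 i)//= eqxx big1 ?addr0// => k /negbTE ->.
    by [].
  - move=> k; rewrite /mu /chi' big_split /= -mE -mulr_sumr.
    congr (_ + _ * _); rewrite (bigD1 j)//= eqxx andbT big1 ?addr0// => l.
    by move=> /negbTE ->; rewrite andbF.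
  - move=> k l; have [p1 p2] := pos k l; rewrite /chi'.
    case: (boolP ((k == i) && (l == j))) => [/andP[/eqP -> /eqP ->]|_].
      split=> h; rewrite mulr1.
        by move: h1; rewrite -/t ltr_norml => /andP[+ _]; lra.
      by move: ijA h; rewrite finset.in_setD => /andP[_ ->].
    by rewrite mulr0 addr0.
have := op _ _ _ feas; rewrite /fluid_profit /lam /mu.
rewrite (sum_perturb1 rev lams t j) (sum_perturb1 cost mus t i) => le.
have {}le : rev j (lams j + t) - rev j (lams j) -
    (cost i (mus i + t) - cost i (mus i)) <= 0.
  move: le; rewrite /rev /cost; lra.
move: q1 q2; rewrite !ler_norml => /andP[q1 _] /andP[_ q2].
have : a * t <= B * t ^+ 2 by rewrite /a /B !mulrDl mulNr; lra.
rewrite /t exprMn expr2 mulrA -expr2 [B * _]mulrCA [s ^+ 2]expr2 mulrA.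
have a2 : 0 < a ^+ 2 by rewrite exprn_even_gt0//= subr_eq0.
rewrite -subr_ge0 => h.
have : 0 < a ^+ 2 * s * (1 - B * s) by rewrite (mulr_gt0 (mulr_gt0 a2 s0))// subr_gt0.
rewrite (_ : a ^+ 2 * s * _ = - (a ^+ 2 * (B * s * s) - a ^+ 2 * s)); last by ring.
by rewrite oppr_gt0 ltNge; move: h; rewrite !mulrA => ->.
Qed.

End Fluid.

(** * Drift under max-weight matching *)

Section OneSide.
Variables (R : realType) (T U : finType) (e : T -> U -> bool).
Variables (x : T -> nat) (y : U -> nat).

(** Over an empty set of partners the maximum is 0, so a type without usable edges behaves as if all
    its partner queues were empty. *)
Definition longest (t : T) : nat := \max_(u | e t u) y u.

(** Convertible to [best_servers] and [best_customers], so that each fact proved here serves both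
    sides. *)
Definition best (t : T) : {set U} :=
  [set u | [&& e t u, (0 < y u)%N & [forall u', e t u' ==> (y u' <= y u)%N]]].

Lemma best_longest t u : u \in best t -> [/\ e t u, (0 < y u)%N & y u = longest t].
Proof.
rewrite inE => /and3P[tu u0 /forallP umax]; split => //.
apply/eqP; rewrite eqn_leq (leq_bigmax_cond _ tu) /=.
by apply/bigmax_leqP => u' tu'; apply: (implyP (umax u')).
Qed.

Lemma longest_attained t : (0 < longest t)%N ->
  exists2 u, e t u & longest t = y u.
Proof.
move=> l0; have [u tu lE] : {u | e t u & longest t = y u}; last by exists u.
apply: eq_bigmax_cond; rewrite lt0n; apply: contraTneq l0 => /card0_eq e0.
by rewrite /longest big_pred0.
Qed.

Lemma best_eq0 t : (best t == finset.set0) = (longest t == 0)%N.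
Proof.
apply/eqP/eqP => [b0|l0].
  apply/eqP; rewrite -leqn0 leqNgt; apply/negP => l0.
  have [u tu lE] := longest_attained l0.
  have : u \in best t.
    rewrite inE tu -lE l0; apply/forallP => u'; apply/implyP => tu'.
    exact: leq_bigmax_cond.
  by rewrite b0 inE.
apply/setP => u; rewrite [in RHS]inE; apply/negP => /best_longest [_ u0].
by rewrite l0 => yu; rewrite yu in u0.
Qed.

Variables (c : T -> U -> R) (l : T -> R) (m : U -> R).
Hypothesis c_ge0 : forall t u, 0 <= c t u.
Hypothesis c_eq0 : forall t u, ~~ e t u -> c t u = 0.
Hypothesis lE : forall t, l t = \sum_u c t u.
Hypothesis mE : forall u, m u = \sum_t c t u.

(** Max-weight against static routing: serving the longest partner queue is worth at least as much
    as splitting the arrivals along the flow [c]. *)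
Lemma sum_longest_ge :
  \sum_u m u * (y u)%:R <= \sum_t l t * (longest t)%:R.
Proof.
under eq_bigr do rewrite mE mulr_suml.
rewrite exchange_big /=; apply: ler_sum => t _; rewrite lE mulr_suml.
apply: ler_sum => u _; have [tu|/c_eq0 ->] := boolP (e t u); last by rewrite !mul0r.
by apply: ler_wpM2l => //; rewrite ler_nat; exact: leq_bigmax_cond.
Qed.

Variables (eta sigma s : R) (theta : T -> R) (on : T -> bool).
Hypothesis sigma_ge0 : 0 <= sigma.
Hypothesis theta_ge0 : forall t, 0 <= theta t.
Hypothesis theta_le : \sum_t theta t <= s.
Hypothesis l_large : forall t, 2 * (sigma * s) <= eta * l t.
Hypothesis m_large : forall u, 2 * (sigma * s) <= eta * m u.
Hypothesis on_gt0 : forall t, on t -> (0 < x t)%N.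

(* Arrivals of type [t] push [x t] up or the longest partner queue down.  The
   two sums with a factor [1 / 2] absorb the states in which compatible queues
   on both sides are nonempty. *)
Lemma one_sided_drift (longest' : U -> nat) :
  (forall t u, e t u -> x t <= longest' u)%N ->
  \sum_t (eta * l t - theta t * sigma * (on t)%:R) *
    ((x t)%:R * (longest t == 0%N)%:R - (longest t)%:R) <=
  eta * (\sum_t l t * (x t)%:R - \sum_t l t * (longest t)%:R)
  - (\sum_t eta * l t * ((x t)%:R * (0 < longest t)%N%:R)) / 2
  + (\sum_u eta * m u * ((y u)%:R * (0 < longest' u)%N%:R)) / 2
  - sigma * \sum_t theta t * ((on t)%:R * (x t)%:R).
Proof.
move=> xl'.
pose Z : R := \sum_u (y u)%:R * (0 < longest' u)%N%:R.
have Z0 : 0 <= Z by apply: sumr_ge0 => u _; rewrite mulr_ge0.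
have s0 : 0 <= s by apply: le_trans theta_le; exact: sumr_ge0.
have theta_s t : theta t <= s.
  by apply: le_trans theta_le; rewrite (bigD1 t)//= lerDl sumr_ge0.
(* A reduced rate means that [x t] is positive. Hence the longest partner [u] of [t] has
   [longest' u] positive, and its term in [Z] is all of [longest t]. *)
have onZ t : (on t)%:R * (longest t)%:R <= Z.
  case: (boolP (on t)) => [/on_gt0 x0|_]; last by rewrite mul0r.
  have [->|l0] := posnP (longest t); first by rewrite mulr0.
  have [u tu ->] := longest_attained l0.
  rewrite mul1r /Z (bigD1 u)//= (leq_trans x0 (xl' _ _ tu)) mulr1 lerDl.
  by apply: sumr_ge0 => u' _; rewrite mulr_ge0.
(* This error is charged to the other side. When the lemma is added to its mirror image, the two
   sums with a factor [1 / 2] cancel against those subtracted there. *)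
have hZ : sigma * \sum_t theta t * ((on t)%:R * (longest t)%:R) <=
    (\sum_u eta * m u * ((y u)%:R * (0 < longest' u)%N%:R)) / 2.
  apply: (@le_trans _ _ (sigma * s * Z)).
    rewrite -mulrA; apply: ler_wpM2l => //.
    apply: (@le_trans _ _ (\sum_t theta t * Z)).
      by apply: ler_sum => t _; exact: ler_wpM2l.
    by rewrite -mulr_suml ler_wpM2r.
  rewrite ler_pdivlMr// /Z mulr_sumr mulr_suml; apply: ler_sum => u _.
  rewrite mulrAC ler_wpM2r ?mulr_ge0// mulrC; exact: m_large.
have hX : sigma * \sum_t theta t * ((on t)%:R * ((x t)%:R * (0 < longest t)%N%:R))
    <= (\sum_t eta * l t * ((x t)%:R * (0 < longest t)%N%:R)) / 2.
  rewrite ler_pdivlMr// mulr_sumr mulr_suml; apply: ler_sum => t _.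
  rewrite [(on t)%:R * _]mulrC !mulrA.
  set X := (x t)%:R; set L := _%:R : R.
  have XL : 0 <= X * L by rewrite mulr_ge0.
  have h : sigma * theta t * (on t)%:R * 2 <= eta * l t.
    apply: le_trans (l_large t); rewrite mulrC; apply: ler_wpM2l => //.
    by case: (on t); rewrite ?mulr1 ?mulr0 ?ler_wpM2l// mulr_ge0.
  have := ler_wpM2r XL h; rewrite !mulrA; apply: le_trans.
  by rewrite le_eqVlt; apply/orP; left; apply/eqP; ring.
(* The indicator of an empty [longest t] is 1 minus that of a nonempty one. This isolates the
   negative sum of which [hX] uses one half. *)
have -> : \sum_t (eta * l t - theta t * sigma * (on t)%:R) *
    ((x t)%:R * (longest t == 0%N)%:R - (longest t)%:R) =
  eta * (\sum_t l t * (x t)%:R - \sum_t l t * (longest t)%:R) -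
  \sum_t eta * l t * ((x t)%:R * (0 < longest t)%N%:R) -
  sigma * \sum_t theta t * ((on t)%:R * (x t)%:R) +
  sigma * \sum_t theta t * ((on t)%:R * ((x t)%:R * (0 < longest t)%N%:R)) +
  sigma * \sum_t theta t * ((on t)%:R * (longest t)%:R).
  rewrite -sumrB !mulr_sumr -!sumrB -!big_split /=; apply: eq_bigr => t _.
  by rewrite lt0n; case: (longest t == 0%N) => /=; ring.
lra.
Qed.

End OneSide.

Section Branch.
Variables (R : realType) (S : Type) (U : finType).

(** The mean of [f] after one arrival: the arrival joins its own queue in [up], and takes the
    partner [u] with probability [p u] in [dn u]. *)
Definition branch (B : {set U}) (p : U -> R) (up : S) (dn : U -> S)
    (f : S -> R) : R :=
  if B == finset.set0 then f up else \sum_(u in B) p u * f (dn u).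

Lemma branch_sub B p up dn f c :
  (B != finset.set0 -> \sum_(u in B) p u = 1) ->
  branch B p up dn f - c = branch B p up dn (fun q => f q - c).
Proof.
rewrite /branch; case: eqP => // _ /(_ isT) p1.
rewrite -[X in _ - X]mul1r -p1 mulr_suml -sumrB.
by apply: eq_bigr => u _; rewrite mulrBr.
Qed.

(** Ties become irrelevant here: the test functions used below take the same value whichever longest
    partner is chosen. *)
Lemma branch_eq B p up dn f (d d' : R) :
  (B != finset.set0 -> \sum_(u in B) p u = 1) ->
  f up = d -> (forall u, u \in B -> f (dn u) = d') ->
  branch B p up dn f = if B == finset.set0 then d else d'.
Proof.
rewrite /branch => p1 fu fd; case: eqP p1 => // _ /(_ isT) p1.
rewrite -[RHS]mul1r -p1 mulr_suml; apply: eq_bigr => u uB.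
by rewrite fd.
Qed.

End Branch.

Lemma natr_incr (R : pzRingType) (T : finType) (q : {ffun T -> nat}) t u :
  (incr q t u)%:R = (q u)%:R + 1 * (u == t)%:R :> R.
Proof. by rewrite ffunE natrD mul1r. Qed.

Lemma natr_decr (R : pzRingType) (T : finType) (q : {ffun T -> nat}) t u :
  (0 < q t)%N -> (decr q t u)%:R = (q u)%:R + (-1) * (u == t)%:R :> R.
Proof.
move=> q0; rewrite ffunE; have [->|_] := eqVneq u t.
  by rewrite natrB// mulr1.
by rewrite subn0 mulr0 addr0.
Qed.

(** * The queueing system as a Markov chain driven by events *)

Section Queue.
Variables (R : realType) (N M : finType).
Local Notation Q := (state N M).
(* [inl (inl j)]: a customer of type [j] joins its queue; [inl (inr (j, i))]: it
   is matched with a waiting server of type [i]; [inr]: same for servers. *)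
Local Notation event := ((M + M * N) + (N + N * M))%type.

Definition bounded_states (n : nat) : set Q :=
  [set q : Q | (forall j, (q.1 j <= n)%N) /\ (forall i, (q.2 i <= n)%N)].

Lemma bounded_states_finite n : finite_set (bounded_states n).
Proof.
pose F (p : {ffun M -> 'I_n.+1} * {ffun N -> 'I_n.+1}) : Q :=
  ([ffun j => nat_of_ord (p.1 j)], [ffun i => nat_of_ord (p.2 i)]).
apply: (@sub_finite_set _ _ (F @` setT)); last first.
  exact/finite_image/finite_finset.
move=> [x y] [/= xn yn].
exists ([ffun j => inord (x j)], [ffun i => inord (y i)]) => //.
by congr (_, _); apply/ffunP => k; rewrite !ffunE inordK// ltnS.
Qed.

Definition target (q : Q) (e : event) : Q :=
  match e with
  | inl (inl j) => (incr q.1 j, q.2)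
  | inl (inr ji) => (q.1, decr q.2 ji.2)
  | inr (inl i) => (q.1, incr q.2 i)
  | inr (inr ij) => (decr q.1 ij.2, q.2)
  end.

(** An event changes a single queue by at most 1, so all predecessors of [q] lie in a bounded
    box. *)
Lemma target_source_finite q : finite_set [set x | exists e, target x e = q].
Proof.
pose n := (\sum_j q.1 j + \sum_i q.2 i).+1%N.
apply: sub_finite_set (bounded_states_finite n) => x [e xe].
have sumL (T : finType) (F : T -> nat) k : (F k <= \sum_l F l)%N.
  by rewrite (bigD1 k)//= leq_addr.
have subL a (b : bool) : (a <= (a - b).+1)%N by case: b => /=; lia.
have addL a (b : bool) : (a <= (a + b).+1)%N by lia.
split=> k.
  apply: (@leq_trans (q.1 k).+1); last first.
    by rewrite ltnS (leq_trans (sumL _ _ k))// leq_addr.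
  by rewrite -xe; case: {xe}e => [[j|ji]|[i|ij]] /=; rewrite ?ffunE.
apply: (@leq_trans (q.2 k).+1); last first.
  by rewrite ltnS (leq_trans (sumL _ _ k))// leq_addl.
by rewrite -xe; case: {xe}e => [[j|ji]|[i|ij]] /=; rewrite ?ffunE.
Qed.

Variables (A : {set N * M}) (t : tie_rule R N M).
Hypothesis ht : valid_tie_rule A t.
Variables (lam : Q -> M -> R) (mu : Q -> N -> R).
Implicit Types (f : Q -> R) (q : Q).

(** The indicators give rate 0 to events that are impossible in [q], such as a match with an empty
    queue. They also discard the values of the tie rule outside the best partners, whose sign is
    unconstrained. *)
Definition event_rate q (e : event) : R :=
  match e with
  | inl (inl j) => lam q j * (best_servers A q j == finset.set0)%:R
  | inl (inr ji) => lam q ji.1 *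
      ((ji.2 \in best_servers A q ji.1)%:R * tie_cust t q ji.1 ji.2)
  | inr (inl i) => mu q i * (best_customers A q i == finset.set0)%:R
  | inr (inr ij) => mu q ij.1 *
      ((ij.2 \in best_customers A q ij.1)%:R * tie_serv t q ij.1 ij.2)
  end.

Definition cust_branch f q j : R :=
  branch (best_servers A q j) (tie_cust t q j) (incr q.1 j, q.2)
    (fun i => (q.1, decr q.2 i)) f.

Definition serv_branch f q i : R :=
  branch (best_customers A q i) (tie_serv t q i) (q.1, incr q.2 i)
    (fun j => (decr q.1 j, q.2)) f.

Let split_branch (T U : finType) (r : T -> R) (B : T -> {set U})
    (p : T -> U -> R) (up : T -> Q) (dn : U -> Q) f :
  \sum_k r k * (B k == finset.set0)%:R * f (up k) +
  \sum_(ku : T * U) r ku.1 * ((ku.2 \in B ku.1)%:R * p ku.1 ku.2) * f (dn ku.2) =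
  \sum_k r k * branch (B k) (p k) (up k) dn f.
Proof.
rewrite -(pair_bigA _ (fun k u => r k * ((u \in B k)%:R * p k u) * f (dn u))) /=.
rewrite -big_split; apply: eq_bigr => k _ /=; rewrite /branch.
case: eqP => [->|_].
  rewrite mulr1 big1 ?addr0// => u _.
  by rewrite inE mul0r mulr0 mul0r.
rewrite mulr0 mul0r add0r mulr_sumr [RHS]big_mkcond; apply: eq_bigr => u _.
by case: ifP => _; rewrite ?mul1r ?mul0r ?mulr0 ?mul0r// mulrA.
Qed.

Lemma jump_branch f q : jump event_rate target f q =
  \sum_j lam q j * cust_branch f q j + \sum_i mu q i * serv_branch f q i.
Proof.
rewrite /jump !big_sumType /=; congr (_ + _).
  exact: (split_branch (lam q) (best_servers A q) (tie_cust t q)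
    (fun j => (incr q.1 j, q.2)) (fun i => (q.1, decr q.2 i)) f).
exact: (split_branch (mu q) (best_customers A q) (tie_serv t q)
  (fun i => (q.1, incr q.2 i)) (fun j => (decr q.1 j, q.2)) f).
Qed.

Let cust_prob q j : best_servers A q j != finset.set0 ->
  \sum_(i in best_servers A q j) tie_cust t q j i = 1.
Proof. by case: ht => /(_ q j) h _ /h []. Qed.

Let serv_prob q i : best_customers A q i != finset.set0 ->
  \sum_(j in best_customers A q i) tie_serv t q i j = 1.
Proof. by case: ht => _ /(_ q i) h /h []. Qed.

Lemma total_event_rate q :
  total_rate event_rate q = \sum_j lam q j + \sum_i mu q i.
Proof.
rewrite -[LHS]mulr1 -(jump_cst event_rate target) jump_branch.
congr (_ + _); apply: eq_bigr => k _.
  rewrite /cust_branch (branch_eq (d := 1) (d' := 1)) ?if_same ?mulr1//.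
  exact: cust_prob.
rewrite /serv_branch (branch_eq (d := 1) (d' := 1)) ?if_same ?mulr1//.
exact: serv_prob.
Qed.

Lemma gen_branch f q : gen event_rate target f q =
  \sum_j lam q j * cust_branch (fun x => f x - f q) q j +
  \sum_i mu q i * serv_branch (fun x => f x - f q) q i.
Proof.
rewrite /gen jump_branch total_event_rate mulrDl opprD addrACA.
by congr (_ + _); rewrite mulr_suml -sumrB; apply: eq_bigr => k _;
  rewrite -mulrBr /cust_branch /serv_branch branch_sub//;
  [exact: cust_prob|exact: serv_prob].
Qed.

Lemma event_rate_ge0 : (forall q j, 0 <= lam q j) ->
  (forall q i, 0 <= mu q i) -> forall q e, 0 <= event_rate q e.
Proof.
move=> lam0 mu0 q [[j|[j i]]|[i|[i j]]] /=; rewrite mulr_ge0//.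
  have [iB|_] := boolP (i \in _); last by rewrite mul0r.
  rewrite mul1r; case: ht => /(_ q j) h _; case: h => //.
  by apply/set0Pn; exists i.
have [jB|_] := boolP (j \in _); last by rewrite mul0r.
rewrite mul1r; case: ht => _ /(_ q i) h; case: h => //.
by apply/set0Pn; exists j.
Qed.

Lemma stationary_event pi :
  stationary A t lam mu pi <-> is_stationary event_rate target pi.
Proof.
have E q q' : jump_rate A t lam mu q q' =
    jump event_rate target (fun x => (q' == x)%:R) q by rewrite jump_branch.
split=> -[p0 p1 bal]; split=> // q'.
  by rewrite total_event_rate -bal; apply: eq_esum => q _; rewrite E.
by rewrite -total_event_rate -bal; apply: eq_esum => q _; rewrite E.
Qed.

Definition linear_state (r : M -> R) (c : N -> R) q : R :=
  \sum_j r j * (q.1 j)%:R + \sum_i c i * (q.2 i)%:R.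

(** A customer of type [k] who joins adds [r k]; one who is matched removes a server worth
    [c i = - r k]. Both change the function equally, so only arrival rates enter the drift. *)
Lemma gen_linear_state r c :
  (forall i j, (i, j) \in A -> r j = - c i) -> forall q,
  gen event_rate target (linear_state r c) q =
  \sum_j lam q j * r j + \sum_i mu q i * c i.
Proof.
move=> rc q; rewrite gen_branch.
have incE (T : finType) (x : {ffun T -> nat}) (F : T -> R) k :
    \sum_u F u * (incr x k u)%:R = \sum_u F u * (x u)%:R + F k.
  under eq_bigr do rewrite natr_incr.
  by rewrite (sum_perturb1 (fun u => *%R (F u))) mulrDr mulr1 addrAC subrr add0r.
have decE (T : finType) (x : {ffun T -> nat}) (F : T -> R) k : (0 < x k)%N ->
    \sum_u F u * (decr x k u)%:R = \sum_u F u * (x u)%:R - F k.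
  move=> x0; under eq_bigr do rewrite natr_decr//.
  by rewrite (sum_perturb1 (fun u => *%R (F u))) mulrDr mulrN1 addrAC subrr add0r.
congr (_ + _); apply: eq_bigr => k _; congr (_ * _).
  rewrite /cust_branch (branch_eq (d := r k) (d' := r k)) ?if_same//.
  - exact: cust_prob.
  - by rewrite /linear_state /= incE; ring.
  - move=> i /(@best_longest _ _ (fun j i => (i, j) \in A)) [ij q0 _].
    by rewrite /linear_state /= decE// (rc _ _ ij); ring.
rewrite /serv_branch (branch_eq (d := c k) (d' := c k)) ?if_same//.
- exact: serv_prob.
- by rewrite /linear_state /= incE; ring.
- move=> j /(@best_longest _ _ (fun i j => (i, j) \in A)) [ij q0 _].
  by rewrite /linear_state /= decE// (rc _ _ ij); ring.
Qed.

Definition squared_state q : R :=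
  \sum_j (q.1 j)%:R ^+ 2 + \sum_i (q.2 i)%:R ^+ 2.

Let servers_of (j : M) (i : N) := (i, j) \in A.
Let customers_of (i : N) (j : M) := (i, j) \in A.

(** A queue of length [x] that moves by one changes its square by [2 * x + 1] or [- 2 * x + 1]; the
    ones add up to the total arrival rate. *)
Lemma gen_squared_state q :
  gen event_rate target squared_state q =
  2 * (\sum_j lam q j * ((q.1 j)%:R * (longest servers_of q.2 j == 0%N)%:R -
                         (longest servers_of q.2 j)%:R)) +
  2 * (\sum_i mu q i * ((q.2 i)%:R * (longest customers_of q.1 i == 0%N)%:R -
                        (longest customers_of q.1 i)%:R)) +
  (\sum_j lam q j + \sum_i mu q i).
Proof.
rewrite gen_branch.
have incE (T : finType) (x : {ffun T -> nat}) k :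
    \sum_u (incr x k u)%:R ^+ 2 = \sum_u (x u)%:R ^+ 2 + (2 * (x k)%:R + 1) :> R.
  under eq_bigr do rewrite natr_incr.
  by rewrite (sum_perturb1 (fun u (y : R) => y ^+ 2)); ring.
have decE (T : finType) (x : {ffun T -> nat}) k : (0 < x k)%N ->
    \sum_u (decr x k u)%:R ^+ 2 = \sum_u (x u)%:R ^+ 2 + (- 2 * (x k)%:R + 1) :> R.
  move=> x0; under eq_bigr do rewrite natr_decr//.
  by rewrite (sum_perturb1 (fun u (y : R) => y ^+ 2)); ring.
rewrite addrACA !mulr_sumr -!big_split /=; congr (_ + _); apply: eq_bigr => k _.
  rewrite /cust_branch (branch_eq (d := 2 * (q.1 k)%:R + 1)
    (d' := - 2 * (longest servers_of q.2 k)%:R + 1)).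
  - rewrite (best_eq0 servers_of); case: eqP => [->|_] /=; ring.
  - exact: cust_prob.
  - by rewrite /squared_state /= incE; ring.
  - move=> i /(@best_longest _ _ servers_of) [_ q0 lE].
    by rewrite /squared_state /= decE// -lE; ring.
rewrite /serv_branch (branch_eq (d := 2 * (q.2 k)%:R + 1)
  (d' := - 2 * (longest customers_of q.1 k)%:R + 1)).
- rewrite (best_eq0 customers_of); case: eqP => [->|_] /=; ring.
- exact: serv_prob.
- by rewrite /squared_state /= incE; ring.
- move=> j /(@best_longest _ _ customers_of) [_ q0 lE].
  by rewrite /squared_state /= decE// -lE; ring.
Qed.

End Queue.

(** * The two-price policy *)

(** The inverse of 1 plus the sum of the inverses serves as the bound, also when [T] is empty. *)
Lemma finite_positive_lower_bound (R : realFieldType) (T : finType)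
    (F : T -> R) : (forall t, 0 < F t) -> exists2 c, 0 < c & forall t, c <= F t.
Proof.
move=> F0; have s0 : 0 <= \sum_t (F t)^-1 by apply: sumr_ge0 => t _; rewrite invr_ge0 ltW.
have p0 : 0 < 1 + \sum_t (F t)^-1 by rewrite ltr_pwDl.
exists (1 + \sum_t (F t)^-1)^-1; first by rewrite invr_gt0.
move=> t; rewrite -[leRHS]invrK lef_pV2 ?posrE ?invr_gt0//.
rewrite (bigD1 t)//= addrCA lerDl addr_ge0// sumr_ge0// => u _.
by rewrite invr_ge0 ltW.
Qed.

Section TwoPrice.
Variables (R : realType) (N M : finType) (K : market R N M).
Hypothesis hK : market_assumptions K.
Variables (lams : M -> R) (mus : N -> R) (chis : N -> M -> R).
Hypothesis hopt : fluid_optimal K lams mus chis.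
Variables (theta : M -> R) (phi : N -> R).
Hypotheses (htheta : forall j, 0 < theta j) (hphi : forall i, 0 < phi i).
Variable t : tie_rule R N M.
Let A := (compat K :\: redundant K)%SET.
Hypothesis ht : valid_tie_rule A t.

Variables (r Cr dr : M -> R) (c Cc dc : N -> R).
Hypothesis rev_approx : forall j, quadratic_approx [set` cust_range K j]
  (fun x => x * demand K j x) (lams j) (r j) (Cr j) (dr j).
Hypothesis cost_approx : forall i, quadratic_approx [set` serv_range K i]
  (fun x => x * supply K i x) (mus i) (c i) (Cc i) (dc i).

Let S := \sum_j theta j + \sum_i phi i.
Let S2 := \sum_j lams j + \sum_i mus i.

Variables (eta : nat) (T tau kappa : R).
Hypotheses (T_gt0 : 0 < T) (etaE : eta%:R = T ^+ 3)
  (shiftE : price_shift R eta = T ^+ 2).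
Hypothesis htau : 0 <= tau <= T.
Hypotheses (theta_small : forall j, theta j / T < dr j)
  (phi_small : forall i, phi i / T < dc i).
Hypotheses (lams_large : forall j, 2 * S <= T * lams j)
  (mus_large : forall i, 2 * S <= T * mus i).
Hypotheses (kappa_gt0 : 0 < kappa) (kappa_theta : forall j, kappa <= theta j)
  (kappa_phi : forall i, kappa <= phi i).

Let lam := two_price_cust eta lams theta tau : state N M -> M -> R.
Let mu := two_price_serv eta mus phi tau : state N M -> N -> R.
Let w := event_rate A t lam mu.
Let tgt := @target N M.
Let on_cust (q : state N M) j := (tau < (q.1 j)%:R)%R.
Let on_serv (q : state N M) i := (tau < (q.2 i)%:R)%R.

Let lamE q j : lam q j = T ^+ 3 * lams j - theta j * T ^+ 2 * (on_cust q j)%:R.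
Proof. by rewrite /lam /two_price_cust etaE shiftE. Qed.

Let muE q i : mu q i = T ^+ 3 * mus i - phi i * T ^+ 2 * (on_serv q i)%:R.
Proof. by rewrite /mu /two_price_serv etaE shiftE. Qed.

Let theta_le_S : \sum_j theta j <= S.
Proof. by rewrite lerDl sumr_ge0// => i _; exact: ltW. Qed.

Let phi_le_S : \sum_i phi i <= S.
Proof. by rewrite lerDr sumr_ge0// => j _; exact: ltW. Qed.

Let S_ge0 : 0 <= S.
Proof. by rewrite addr_ge0// sumr_ge0// => k _; exact: ltW. Qed.

Let lams_large' j : 2 * (T ^+ 2 * S) <= T ^+ 3 * lams j.
Proof.
rewrite mulrCA (_ : T ^+ 3 * lams j = T ^+ 2 * (T * lams j)); last by ring.
by rewrite ler_wpM2l// exprn_ge0// ltW.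
Qed.

Let mus_large' i : 2 * (T ^+ 2 * S) <= T ^+ 3 * mus i.
Proof.
rewrite mulrCA (_ : T ^+ 3 * mus i = T ^+ 2 * (T * mus i)); last by ring.
by rewrite ler_wpM2l// exprn_ge0// ltW.
Qed.

Let T2_gt0 : 0 < T ^+ 2. Proof. by rewrite exprn_gt0. Qed.

Let rate_ge0 (U : finType) (l th : U -> R) (b : bool) u :
  (forall v, 0 < th v) -> \sum_v th v <= S ->
  2 * (T ^+ 2 * S) <= T ^+ 3 * l u ->
  0 <= T ^+ 3 * l u - th u * T ^+ 2 * b%:R <= T ^+ 3 * l u.
Proof.
move=> th0 thS large.
have thu : th u <= S.
  by apply: le_trans thS; rewrite (bigD1 u)//= lerDl sumr_ge0// => v _; exact: ltW.
have h : T ^+ 2 * th u <= T ^+ 2 * S by rewrite ler_pM2l.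
have h0 : 0 < T ^+ 2 * th u by rewrite mulr_gt0.
by rewrite [th u * _]mulrC; case: b; rewrite ?mulr1 ?mulr0; apply/andP; split; lra.
Qed.

Let lam_bounds q j : 0 <= lam q j <= T ^+ 3 * lams j.
Proof. by rewrite lamE; exact: rate_ge0. Qed.

Let mu_bounds q i : 0 <= mu q i <= T ^+ 3 * mus i.
Proof. by rewrite muE; exact: rate_ge0. Qed.

Let w_ge0 q e : 0 <= w q e.
Proof.
apply: event_rate_ge0 => // x k.
  by have /andP[] := lam_bounds x k.
by have /andP[] := mu_bounds x k.
Qed.

Let total_rate_le q : total_rate w q <= T ^+ 3 * S2.
Proof.
rewrite /w total_event_rate// /S2 mulrDr !mulr_sumr.
by apply: lerD; apply: ler_sum => k _; [have /andP[] := lam_bounds q k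
  |have /andP[] := mu_bounds q k].
Qed.

Let size_state (q : state N M) : R :=
  \sum_j (q.1 j)%:R + \sum_i (q.2 i)%:R.

Let size_ge0 q : 0 <= size_state q.
Proof. by rewrite addr_ge0// sumr_ge0. Qed.

(** Every optimal flow vanishes on redundant edges, so the fluid rates are balanced along [A]
    alone. *)
Let flow : exists chi : N -> M -> R,
  [/\ forall i j, 0 <= chi i j, forall i j, (i, j) \notin A -> chi i j = 0,
      forall j, lams j = \sum_i chi i j & forall i, mus i = \sum_j chi i j].
Proof.
have [chi [opt _]] := fluid_optimal_positive hK hopt.
exists chi; have [[_ _ lE mE pos] _] := opt; split=> // i j.
  have [h1 h2] := pos i j; have [/h1//|/h2 ->//] := boolP ((i, j) \in compat K).
move=> ijA; exact: (redundant_eq0 (e := (i, j)) opt).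
Qed.

(** A queue that does not exceed its threshold has length at most [T], so omitting it costs at most
    [th v * T]. The upper bound on [tau] enters here. *)
Let shut_down_le (U : finType) (th : U -> R) (x : U -> nat) :
  (forall v, 0 < th v) -> (forall v, kappa <= th v) -> \sum_v th v <= S ->
  kappa * \sum_v (x v)%:R - (\sum_v th v) * T <=
  \sum_v th v * ((tau < (x v)%:R)%R%:R * (x v)%:R).
Proof.
move=> th0 kth thS; rewrite mulr_sumr mulr_suml -sumrB; apply: ler_sum => v _.
have /andP[tau0 tauT] := htau.
have h1 : kappa * (x v)%:R <= th v * (x v)%:R by rewrite ler_wpM2r.
case: ltP => [_|xt].
  by rewrite mul1r; have := mulr_gt0 (th0 v) T_gt0; lra.
rewrite mul0r mulr0 subr_le0 (le_trans h1)// ler_pM2l//.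
exact: le_trans tauT.
Qed.

(** Adding the two one-sided drifts cancels the half sums, and [sum_longest_ge] on both sides makes
    the fluid terms nonpositive. In the constant, [2 * S] pays for queues below their thresholds and
    [S2] for the unit jumps in the squares. *)
Let drift q : gen w tgt (@squared_state R N M) q <=
  T ^+ 3 * (2 * S + S2) - 2 * T ^+ 2 * kappa * size_state q.
Proof.
have [chi [chi0 chiA lE mE]] := flow.
have T2_ge0 := ltW T2_gt0.
have /andP[tau0 tauT] := htau.
rewrite /w gen_squared_state//.
pose sv (j : M) (i : N) := (i, j) \in A.
pose cu (i : N) (j : M) := (i, j) \in A.
have on_gt0 (U : finType) (x : U -> nat) u : (tau < (x u)%:R)%R -> (0 < x u)%N.
  by move=> /(le_lt_trans tau0); rewrite ltr0n.
have h1 := @one_sided_drift R M N sv q.1 q.2 lams mus (T ^+ 3) (T ^+ 2) S theta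
  (on_cust q) T2_ge0 (fun j => ltW (htheta j)) theta_le_S lams_large' mus_large'
  (fun j => on_gt0 _ q.1 j) (longest cu q.1)
  (fun j i ij => leq_bigmax_cond (P := cu i) (F := q.1) j ij).
have h2 := @one_sided_drift R N M cu q.2 q.1 mus lams (T ^+ 3) (T ^+ 2) S phi
  (on_serv q) T2_ge0 (fun j => ltW (hphi j)) phi_le_S mus_large' lams_large'
  (fun i => on_gt0 _ q.2 i) (longest sv q.2)
  (fun i j ij => leq_bigmax_cond (P := sv j) (F := q.2) i ij).
have h3 := @sum_longest_ge R M N sv q.2 (fun j i => chi i j) lams mus
  (fun j i => chi0 i j) (fun j i ij => chiA i j ij) lE mE.
have h4 := @sum_longest_ge R N M cu q.1 chi mus lams chi0 chiA mE lE.
have h5 := shut_down_le q.1 htheta kappa_theta theta_le_S.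
have h6 := shut_down_le q.2 hphi kappa_phi phi_le_S.
have h7 : \sum_j lam q j + \sum_i mu q i <= T ^+ 3 * S2.
  by rewrite -(total_event_rate ht); exact: total_rate_le.
rewrite (eq_bigr _ (fun j _ => congr1 (fun z => z * _) (lamE q j))).
rewrite (eq_bigr _ (fun i _ => congr1 (fun z => z * _) (muE q i))).
move: h1 h2; rewrite -/sv -/cu.
move=> h1 h2.
have h8 : T ^+ 2 * (kappa * size_state q - S * T) <=
    T ^+ 2 * (\sum_j theta j * ((on_cust q j)%:R * (q.1 j)%:R) +
              \sum_i phi i * ((on_serv q i)%:R * (q.2 i)%:R)).
  by rewrite ler_pM2l// /size_state mulrDr /S; lra.
have T3 : 0 <= T ^+ 3 by rewrite exprn_ge0// ltW.
have := ler_wpM2l T3 h3; have := ler_wpM2l T3 h4.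
move: h1 h2 h7 h8; rewrite /size_state /S /S2; lra.
Qed.

Let drift_size q := 2 * T ^+ 2 * kappa * size_state q.

Let slope_gt0 : 0 < 2 * T ^+ 2 * kappa.
Proof. by rewrite !mulr_gt0. Qed.

Let drift_size_ge0 q : 0 <= drift_size q.
Proof. by rewrite mulr_ge0// ltW. Qed.

Let S2_ge0 : 0 <= S2.
Proof.
have q0 : state N M := ([ffun=> 0%N], [ffun=> 0%N]).
have h : 0 <= T ^+ 3 * S2 := le_trans (total_rate_ge0 w_ge0 q0) (total_rate_le q0).
by move: h; rewrite pmulr_rge0 // exprn_gt0.
Qed.

Lemma two_price_stationary_exists : exists pi, stationary A t lam mu pi.
Proof.
have T3 : 0 < T ^+ 3 by rewrite exprn_gt0.
(* The [+ 1] keeps the uniformization rate positive even if [S2] is 0. *)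
have [|||||pi pi_stat] := @stationary_exists R (state N M) _ w tgt w_ge0
  (T ^+ 3 * S2 + 1) _ _ ([ffun=> 0%N], [ffun=> 0%N]) (@squared_state R N M)
  drift_size (T ^+ 3 * (2 * S + S2)) _ drift_size_ge0 drift _ _.
- by rewrite ltr_wpDl// mulr_ge0 ?(ltW T3).
- by move=> q; rewrite (le_trans (total_rate_le q))// lerDl.
- by move=> q; rewrite addr_ge0// sumr_ge0// => k _; exact: sqr_ge0.
- move=> x; pose n := Num.bound `|x / (2 * T ^+ 2 * kappa)|.
  apply: sub_finite_set (@bounded_states_finite N M n) => q /=.
  rewrite /drift_size mulrC -ler_pdivlMr// => qx.
  have {}qx : size_state q <= n%:R.
    apply: le_trans qx (le_trans (ler_norm _) (ltW (archi_boundP _))).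
    exact: normr_ge0.
  split=> k; rewrite -(ler_nat R); apply: le_trans qx; rewrite /size_state.
    by rewrite (bigD1 k)//= -addrA lerDl addr_ge0// sumr_ge0.
  by rewrite [X in _ + X](bigD1 k)//= addrCA lerDl addr_ge0// sumr_ge0.
- exact: target_source_finite.
by exists pi; apply/(stationary_event ht).
Qed.

(** The loss per unit of [T]: curvature errors of revenue and cost, then waiting costs at the mean
    total queue length. It depends on neither [eta] nor [tau], so one constant serves all large
    systems. *)
Definition two_price_loss_constant : R :=
  \sum_j Cr j * theta j ^+ 2 + \sum_i Cc i * phi i ^+ 2 +
  (\sum_j cust_cost K j + \sum_i serv_cost K i) *
  ((2 * S + S2) / (2 * kappa)).

(** * Queue lengths, revenue and loss in stationarity *)

Section Loss.
Variable pi : state N M -> R.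
Hypothesis pi_stat : stationary A t lam mu pi.

Let pi_stat' : is_stationary w tgt pi.
Proof. by apply/(stationary_event ht). Qed.

Let pi_ge0 q : 0 <= pi q. Proof. by case: pi_stat. Qed.
Let pi_total : (\esum_(q in [set: state N M]) (pi q)%:E = 1%:E)%E.
Proof. by case: pi_stat. Qed.

(** Dividing the drift constant, of order [T ^+ 3], by the slope [2 * T ^+ 2 * kappa] leaves order
    [T]. Finiteness of the mean is a conclusion, valid for every stationary distribution. *)
Let size_integrable : integrable_wrt pi size_state /\
  rmean pi size_state <= T * ((2 * S + S2) / (2 * kappa)).
Proof.
have b0 : 0 <= T ^+ 3 * (2 * S + S2).
  by apply: mulr_ge0; [rewrite exprn_ge0 ?ltW|rewrite addr_ge0 ?mulr_ge0].
have h := weighted_sum_drift_le w_ge0 pi_stat' total_rate_le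
  (V := @squared_state R N M) _ drift_size_ge0 b0 drift.
have {}h : (weighted_sum pi drift_size <= (T ^+ 3 * (2 * S + S2))%:E)%E.
  by apply: h => q; rewrite addr_ge0// sumr_ge0// => k _; exact: sqr_ge0.
have Id : integrable_wrt pi drift_size.
  apply: (le_integrable_wrt pi_ge0 (g := drift_size)) => [q|].
    by rewrite ger0_norm.
  exact: le_lt_trans h (ltry _).
have sE : size_state = fun q => (2 * T ^+ 2 * kappa)^-1 * drift_size q.
  by apply/funext => q; rewrite /drift_size mulKf// gt_eqF.
have Is : integrable_wrt pi size_state by rewrite sE; exact: integrable_wrtZ.
split=> //; move: h; rewrite -mean_ge0E// meanE// lee_fin => h.
rewrite sE rmeanZ// mulrC ler_pdivrMr//.
apply: le_trans h _; rewrite le_eqVlt; apply/orP; left; apply/eqP.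
by field; rewrite gt_eqF.
Qed.

Let cust_integrable j : integrable_wrt pi (fun q => (q.1 j)%:R).
Proof.
have [Is _] := size_integrable.
apply: (le_integrable_wrt pi_ge0 (g := fun q => `|size_state q|)) => // q.
rewrite !ger0_norm// /size_state (bigD1 j)//= -addrA lerDl.
by rewrite addr_ge0// sumr_ge0.
Qed.

Let serv_integrable i : integrable_wrt pi (fun q => (q.2 i)%:R).
Proof.
have [Is _] := size_integrable.
apply: (le_integrable_wrt pi_ge0 (g := fun q => `|size_state q|)) => // q.
rewrite !ger0_norm// /size_state [X in _ + X](bigD1 i)//= addrCA lerDl.
by rewrite addr_ge0// sumr_ge0.
Qed.

(* The marginal values agree along every edge, so the first-order effect of the
   price shifts is the drift of this linear function, which has mean 0. *)
Let value := linear_state r (fun i => - c i) : state N M -> R.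

Let value_integrable : integrable_wrt pi value.
Proof.
apply: integrable_wrtD => //; apply: integrable_wrt_sum => // k _;
  exact: integrable_wrtZ.
Qed.

Let value_edge i j : (i, j) \in A -> r j = - - c i.
Proof.
move=> ijA; rewrite opprK.
exact: (marginal_revenue_eq_cost hK hopt ijA (rev_approx j) (cost_approx i)).
Qed.

Let gen_value q : gen w tgt value q =
  \sum_i phi i * T ^+ 2 * (on_serv q i)%:R * c i -
  \sum_j theta j * T ^+ 2 * (on_cust q j)%:R * r j.
Proof.
rewrite /w gen_linear_state//.
have [chi [chi0 chiA lE mE]] := flow.
(* Both sides are the flow-weighted sum of the marginal values common to the two ends of an edge, so
   the unreduced rates contribute nothing to the drift of [value]. *)
have balance : \sum_j lams j * r j = \sum_i mus i * c i.
  under eq_bigr do rewrite lE mulr_suml.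
  rewrite exchange_big /=; apply: eq_bigr => i _; rewrite mE mulr_suml.
  apply: eq_bigr => j _; have [ijA|/chiA ->] := boolP ((i, j) \in A).
    by rewrite (value_edge ijA) opprK.
  by rewrite !mul0r.
have -> : \sum_j lam q j * r j = T ^+ 3 * (\sum_j lams j * r j) -
    \sum_j theta j * T ^+ 2 * (on_cust q j)%:R * r j.
  by rewrite mulr_sumr -sumrB; apply: eq_bigr => j _; rewrite lamE; ring.
have -> : \sum_i mu q i * - c i =
    \sum_i phi i * T ^+ 2 * (on_serv q i)%:R * c i -
    T ^+ 3 * (\sum_i mus i * c i).
  by rewrite mulr_sumr -sumrB; apply: eq_bigr => i _; rewrite muE; ring.
by rewrite balance; ring.
Qed.

(** In fluid scale the rate moves by [th / T]; the quadratic error at this distance is multiplied by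
    [eta = T ^+ 3]. *)
Let first_order (x r0 C d : R) (D : set R) (F : R -> R) (th : R) :
  quadratic_approx D F x r0 C d -> 0 < th -> th / T < d ->
  `|T ^+ 3 * (F x - F (x - th / T)) - th * T ^+ 2 * r0| <= T * (C * th ^+ 2).
Proof.
move=> [C0 d0 FP] th0 thd.
have [|_] := FP (- (th / T)).
  by rewrite normrN gtr0_norm// divr_gt0.
have T3 : 0 < T ^+ 3 by rewrite exprn_gt0.
move=> /(ler_wpM2l (ltW T3)) h.
have -> : T ^+ 3 * (F x - F (x - th / T)) - th * T ^+ 2 * r0 =
    - (T ^+ 3 * (F (x - th / T) - F x - r0 * - (th / T))).
  by field; rewrite gt_eqF.
rewrite normrN normrM (gtr0_norm T3); apply: le_trans h _.
rewrite le_eqVlt; apply/orP; left; apply/eqP.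
by field; rewrite gt_eqF.
Qed.

Let two_price_curve (F : R -> R) (l th : R) (b : bool) :
  (T ^+ 3 * l - th * T ^+ 2 * b%:R) *
    scaled_curve eta F (T ^+ 3 * l - th * T ^+ 2 * b%:R) =
  T ^+ 3 * (l * F l) -
  b%:R * (T ^+ 3 * (l * F l - (l - th / T) * F (l - th / T))).
Proof.
have T0 : T != 0 by rewrite gt_eqF.
rewrite /scaled_curve etaE; case: b; rewrite ?mulr1 ?mulr0 ?subr0 ?mul0r ?mul1r ?subr0.
  rewrite (_ : (T ^+ 3 * l - th * T ^+ 2) / T ^+ 3 = l - th / T); last by field.
  by field.
by rewrite (_ : T ^+ 3 * l / T ^+ 3 = l) ?mulrA//; field.
Qed.

(** [er] and [ec] are what remains of the revenue lost and the cost saved by a reduced rate once the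
    marginal values are taken out. *)
Let er j := T ^+ 3 * (lams j * demand K j (lams j) -
  (lams j - theta j / T) * demand K j (lams j - theta j / T)) -
  theta j * T ^+ 2 * r j.
Let ec i := T ^+ 3 * (mus i * supply K i (mus i) -
  (mus i - phi i / T) * supply K i (mus i - phi i / T)) -
  phi i * T ^+ 2 * c i.

Let error (q : state N M) : R :=
  \sum_i ec i * (on_serv q i)%:R - \sum_j er j * (on_cust q j)%:R.

Let error_le q : `|error q| <=
  T * (\sum_j Cr j * theta j ^+ 2 + \sum_i Cc i * phi i ^+ 2).
Proof.
have nb (x : R) (b : bool) : `|x * b%:R| <= `|x|.
  by case: b; rewrite ?mulr1 ?mulr0 ?normr0.
rewrite /error addrC mulrDr !mulr_sumr; apply: le_trans (ler_normD _ _) _.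
rewrite normrN; apply: lerD; apply: le_trans (ler_norm_sum _ _ _) _;
  apply: ler_sum => k _; apply: le_trans (nb _ _) _.
  exact: first_order (rev_approx k) _ _.
exact: first_order (cost_approx k) _ _.
Qed.

Let revenueE q : \sum_j lam q j * scaled_curve eta (demand K j) (lam q j) -
    \sum_i mu q i * scaled_curve eta (supply K i) (mu q i) =
  T ^+ 3 * fluid_profit K lams mus + (gen w tgt value q + error q).
Proof.
rewrite gen_value /error /fluid_profit.
have -> : \sum_j lam q j * scaled_curve eta (demand K j) (lam q j) =
    T ^+ 3 * (\sum_j lams j * demand K j (lams j)) -
    \sum_j theta j * T ^+ 2 * (on_cust q j)%:R * r j -
    \sum_j er j * (on_cust q j)%:R.
  rewrite mulr_sumr -!sumrB; apply: eq_bigr => j _.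
  by rewrite lamE two_price_curve /er; ring.
have -> : \sum_i mu q i * scaled_curve eta (supply K i) (mu q i) =
    T ^+ 3 * (\sum_i mus i * supply K i (mus i)) -
    \sum_i phi i * T ^+ 2 * (on_serv q i)%:R * c i -
    \sum_i ec i * (on_serv q i)%:R.
  rewrite mulr_sumr -!sumrB; apply: eq_bigr => i _.
  by rewrite muE two_price_curve /ec; ring.
ring.
Qed.

Hypotheses (cust_cost_gt0 : forall j, 0 < cust_cost K j)
  (serv_cost_gt0 : forall i, 0 < serv_cost K i).

Lemma two_price_loss_le :
  (`|profit_loss K eta (fluid_profit K lams mus) lam mu pi| <=
    (two_price_loss_constant * T)%:E)%E.
Proof.
have [Is size_le] := size_integrable.
have meanP f : integrable_wrt pi f -> expectation_of pi f = (rmean pi f)%:E.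
  exact: meanE.
have Ie : integrable_wrt pi error by exact: integrable_wrt_bounded error_le.
have Ig : integrable_wrt pi (gen w tgt value).
  apply: integrable_wrtD => //.
    exact: (integrable_jump w_ge0 pi_stat' total_rate_le).
  by apply: integrable_wrtN => //; exact: (integrable_rate w_ge0 pi_stat' total_rate_le).
pose cst (q : state N M) := T ^+ 3 * fluid_profit K lams mus.
have Ic : integrable_wrt pi cst.
  by apply: (integrable_wrt_bounded pi_ge0 pi_total
    (B := `|T ^+ 3 * fluid_profit K lams mus|)) => q.
have Ige := integrable_wrtD pi_ge0 Ig Ie.
have revE : expectation_of pi (fun q =>
    (\sum_j lam q j * scaled_curve eta (demand K j) (lam q j) -
     \sum_i mu q i * scaled_curve eta (supply K i) (mu q i))%R) =
    (T ^+ 3 * fluid_profit K lams mus + rmean pi error)%:E.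
  rewrite (_ : (fun q => _) = fun q => cst q + (gen w tgt value q + error q)).
    rewrite meanP; last exact: integrable_wrtD.
    rewrite rmeanD// rmeanD// (rmean_cst pi_ge0 pi_total).
    (* Stationarity removes the whole contribution of order [T ^+ 2]. *)
    by rewrite (rmean_gen w_ge0 pi_stat' total_rate_le value_integrable) add0r.
  by apply/funext => q; rewrite revenueE.
rewrite /profit_loss revE etaE.
under eq_bigr do rewrite meanP//.
under [X in (_ - (_ - _ - X))%E]eq_bigr do rewrite meanP//.
under eq_bigr do rewrite -EFinM.
under [X in (_ - (_ - _ - X))%E]eq_bigr do rewrite -EFinM.
rewrite !sumEFin -!EFinB abse_EFin lee_fin.
(* The loss equals the mean waiting cost minus the mean error, so a bound on both gives the absolute
   value. *)
pose wait := \sum_j cust_cost K j * rmean pi (fun q => (q.1 j)%:R) +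
  \sum_i serv_cost K i * rmean pi (fun q => (q.2 i)%:R).
rewrite (_ : _ - _ = wait - rmean pi error); last by rewrite /wait; ring.
have wait0 : 0 <= wait.
  by rewrite addr_ge0// sumr_ge0// => k _; rewrite mulr_ge0 ?rmean_ge0// ltW.
have wait_le : wait <= (\sum_j cust_cost K j + \sum_i serv_cost K i) *
    rmean pi size_state.
  rewrite mulrDl !mulr_suml; apply: lerD; apply: ler_sum => k _.
    rewrite ler_pM2l//; apply: ler_rmean => // q.
    by rewrite /size_state (bigD1 k)//= -addrA lerDl addr_ge0// sumr_ge0.
  rewrite ler_pM2l//; apply: ler_rmean => // q.
  by rewrite /size_state [X in _ + X](bigD1 k)//= addrCA lerDl addr_ge0// sumr_ge0.
have err_le : `|rmean pi error| <=
    T * (\sum_j Cr j * theta j ^+ 2 + \sum_i Cc i * phi i ^+ 2).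
  set B := T * _.
  have IB x : integrable_wrt pi (fun=> x : R).
    by apply: (integrable_wrt_bounded pi_ge0 pi_total (B := `|x|)) => q.
  rewrite ler_norml -(rmean_cst pi_ge0 pi_total (- B)).
  rewrite -[X in _ <= _ <= X](rmean_cst pi_ge0 pi_total B).
  by apply/andP; split; apply: ler_rmean => // q; have := error_le q;
    rewrite ler_norml => /andP[].
have s0 : 0 <= \sum_j cust_cost K j + \sum_i serv_cost K i.
  by rewrite addr_ge0// sumr_ge0// => k _; exact: ltW.
have wait_le' := le_trans wait_le (ler_wpM2l s0 size_le).
apply: le_trans (ler_normB _ _) _; rewrite ger0_norm//.
apply: le_trans (lerD wait_le' err_le) _.
by rewrite /two_price_loss_constant le_eqVlt; apply/orP; left; apply/eqP; ring.
Qed.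

End Loss.
End TwoPrice.

(** * Choice of the constants and conclusion *)

Lemma powR_cube_root (R : realType) (eta : nat) :
  let T : R := eta%:R `^ (1 / 3) in
  eta%:R = T ^+ 3 /\ price_shift R eta = T ^+ 2.
Proof.
rewrite /= -!powR_mulrn ?powR_ge0// -!powRrM; split.
  by rewrite (_ : 1 / 3 * 3%:R = 1) ?powRr1 ?divfK ?mul1r.
by rewrite /price_shift; congr powR; field.
Qed.

Theorem theorem2 (R : realType) (N M : finType) (K : market R N M)
  (hK : market_assumptions K)
  (lams : M -> R) (mus : N -> R) (chis : N -> M -> R)
  (hopt : fluid_optimal K lams mus chis)
  (hlams : forall j, 0 < lams j) (hmus : forall i, 0 < mus i)
  (hlams_int : forall j, [set` cust_range K j]^° (lams j))
  (hmus_int : forall i, [set` serv_range K i]^° (mus i))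
  (theta : M -> R) (phi : N -> R)
  (htheta : forall j, 0 < theta j) (hphi : forall i, 0 < phi i)
  (tau : nat -> R)
  (htau : forall eta : nat, (0 < eta)%N -> 0 <= tau eta <= eta%:R `^ (1 / 3))
  (tie : nat -> tie_rule R N M)
  (htie : forall eta : nat,
     valid_tie_rule (compat K :\: redundant K)%SET (tie eta)) :
  exists C : R, \forall eta \near \oo,
    let A := (compat K :\: redundant K)%SET in
    let lam := two_price_cust eta lams theta (tau eta) in
    let mu := two_price_serv eta mus phi (tau eta) in
    (exists pi, stationary A (tie eta) lam mu pi) /\
    (forall pi, stationary A (tie eta) lam mu pi ->
       (`|profit_loss K eta (fluid_profit K lams mus) lam mu pi|
          <= (C * eta%:R `^ (1 / 3))%:E)%E).
Proof.
have [hrev [hcost [cust_cost_gt0 serv_cost_gt0]]] := hK.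
(* The triple holds the marginal value, the curvature constant and the radius; the interior position
   of the optimal rates provides a two-sided radius. *)
have /choice [rC rev_approx] : forall j, exists p : R * R * R,
    quadratic_approx [set` cust_range K j] (fun x => x * demand K j x)
      (lams j) p.1.1 p.1.2 p.2.
  move=> j; have [_ _ _ _ [f2 df2 _]] := hrev j.
  have [r [C [d h]]] := second_derivative_on_quadratic_approx df2 (hlams_int j).
  by exists (r, C, d).
have /choice [cC cost_approx] : forall i, exists p : R * R * R,
    quadratic_approx [set` serv_range K i] (fun x => x * supply K i x)
      (mus i) p.1.1 p.1.2 p.2.
  move=> i; have [_ _ _ _ [f2 df2 _]] := hcost i.
  have [r [C [d h]]] := second_derivative_on_quadratic_approx df2 (hmus_int i).
  by exists (r, C, d).
have [ka ka0 kaP] := finite_positive_lower_bound htheta.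
have [kb kb0 kbP] := finite_positive_lower_bound hphi.
pose kappa := Num.min ka kb.
have kappa0 : 0 < kappa by rewrite lt_min ka0.
pose S := \sum_j theta j + \sum_i phi i.
have S0 : 0 <= S by rewrite addr_ge0// sumr_ge0// => k _; exact: ltW.
have dr0 j : 0 < (rC j).2 by case: (rev_approx j).
have dc0 i : 0 < (cC i).2 by case: (cost_approx i).
(* A value of [T] above [a j] ensures both that [theta j / T] is within the radius and that
   [T * lams j] is at least [2 * S]; [b i] does the same for servers. *)
pose a j := theta j / (rC j).2 + 2 * S / lams j.
pose b i := phi i / (cC i).2 + 2 * S / mus i.
have a0 j : 0 <= a j by rewrite addr_ge0 ?divr_ge0 ?mulr_ge0// ltW.
have b0 i : 0 <= b i by rewrite addr_ge0 ?divr_ge0 ?mulr_ge0// ltW.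
(* A sum in place of a maximum dominates all [a j] and [b i] at once and makes sense without any
   types. *)
pose T0 := 1 + (\sum_j a j + \sum_i b i).
have T01 : 1 <= T0 by rewrite lerDl addr_ge0// sumr_ge0.
have aT j : a j < T0.
  have h : a j <= \sum_j a j by rewrite (bigD1 j)//= lerDl sumr_ge0.
  have h' : 0 <= \sum_i b i by exact: sumr_ge0.
  by rewrite /T0; lra.
have bT i : b i < T0.
  have h : b i <= \sum_i b i by rewrite (bigD1 i)//= lerDl sumr_ge0.
  have h' : 0 <= \sum_j a j by exact: sumr_ge0.
  by rewrite /T0; lra.
exists (two_price_loss_constant K lams mus theta phi (fun j => (rC j).1.2)
  (fun i => (cC i).1.2) kappa).
apply: filterS (nbhs_infty_ger (T0 ^+ 3)) => eta eta_large /=.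
pose T : R := eta%:R `^ (1 / 3).
have [etaE shiftE] := powR_cube_root R eta.
have T_ge : T0 <= T.
  rewrite -(@ler_pXn2r _ 3)// ?nnegrE ?powR_ge0 ?(le_trans ler01)// -etaE.
  exact: eta_large.
have T_gt0 : 0 < T by apply: lt_le_trans T_ge; exact: lt_le_trans T01.
have eta_gt0 : (0 < eta)%N.
  by rewrite -(ltr0n R) etaE exprn_gt0.
have theta_small j : theta j / T < (rC j).2.
  rewrite ltr_pdivrMr// mulrC -ltr_pdivrMr//.
  apply: le_lt_trans (lt_le_trans (aT j) T_ge).
  by rewrite lerDl divr_ge0 ?mulr_ge0// ltW.
have phi_small i : phi i / T < (cC i).2.
  rewrite ltr_pdivrMr// mulrC -ltr_pdivrMr//.
  apply: le_lt_trans (lt_le_trans (bT i) T_ge).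
  by rewrite lerDl divr_ge0 ?mulr_ge0// ltW.
have lams_large j : 2 * S <= T * lams j.
  rewrite -ler_pdivrMr//; apply: ltW (le_lt_trans _ (lt_le_trans (aT j) T_ge)).
  by rewrite lerDr divr_ge0// ltW.
have mus_large i : 2 * S <= T * mus i.
  rewrite -ler_pdivrMr//; apply: ltW (le_lt_trans _ (lt_le_trans (bT i) T_ge)).
  by rewrite lerDr divr_ge0// ltW.
have kappa_theta j : kappa <= theta j by rewrite ge_min kaP.
have kappa_phi i : kappa <= phi i by rewrite ge_min kbP orbT.
split.
  exact: (two_price_stationary_exists hK hopt htheta hphi (htie eta)
    T_gt0 etaE shiftE (htau eta eta_gt0) lams_large mus_large kappa0 kappa_theta
    kappa_phi).
move=> pi pi_stat.
exact: (two_price_loss_le hK hopt htheta hphi (htie eta) rev_approx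
  cost_approx T_gt0 etaE shiftE (htau eta eta_gt0) theta_small phi_small
  lams_large mus_large kappa0 kappa_theta kappa_phi pi_stat cust_cost_gt0 serv_cost_gt0).
Qed.
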